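(* Let $0<r<1$. Then there is a function $f=f_r:(0,1]\to(0,1]$ with $\lim_{\epsilon\to 0}f(\epsilon)=0$ such that for every pair of real Banach spaces $X$ and $Y$, $$2^{-2/r+1}\,d_{GH}(X,Y)\le d_r(X,Y)\le f(d_{GH}(X,Y)).$$
   Context: For a Banach space $X$, $B_X$ denotes its closed unit ball. For subsets $A,B$ of a (pseudo-)metric space, $d(A,B)$ denotes their Hausdorff distance. The Gromov–Hausdorff distance $d_{GH}(X,Y)$ between Banach spaces is the infimum of the Hausdorff distance between the images of $B_X$ and $B_Y$ over all isometric embeddings of the metric spaces $B_X$ and $B_Y$ (with the norm metrics) into a common metric space. An $r$-norm ($0<r<1$) on a vector space $Z$ is a map $z\mapsto\|z\|_Z$ with $\|z\|_Z>0$ for $z\neq0$, $\|\alpha z\|_Z=|\alpha|\|z\|_Z$, and $\|z_1+z_2\|_Z^r\le\|z_1\|_Z^r+\|z_2\|_Z^r$; $Z$ is an $r$-normed quasi-Banach space if the metric $\|z_1-z_2\|_Z^r$ is complete. For Banach spaces $X,Y$, $d_r(X,Y)$ is the infimum, over all $r$-normed quasi-Banach spaces $Z$ and all linear isometric embeddings of $X$ and $Y$ into $Z$, of the Hausdorff distance between the images of $B_X$ and $B_Y$, measured with $\|z_1-z_2\|_Z$.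
   Formalization: The upper bound d_r(X,Y) ≤ f(d_GH(X,Y)) is stated only when d_GH(X,Y) > 0, since f is defined on (0,1] and f(0) is undefined (for instance when X = Y); the lower bound is stated for all pairs. *)

(* Defs.v *)
From HB Require Import structures.
From mathcomp Require Import all_boot all_order all_algebra.
From mathcomp Require Import all_classical all_reals all_analysis.
Set Implicit Arguments. Unset Strict Implicit. Unset Printing Implicit Defensive.
Import Order.TTheory GRing.Theory Num.Theory.
Import numFieldNormedType.Exports.
Local Open Scope classical_set_scope.
Local Open Scope ring_scope.

Section Defs.
Variable R : realType.

Definition unit_ball (X : normedModType R) : set X := [set x : X | `|x| <= 1].
Arguments unit_ball : clear implicits.

Definition hausdorff {Z : Type} (d : Z -> Z -> R) (A B : set Z) : \bar R :=
  maxe (ereal_sup [set ereal_inf [set (d a b)%:E | b in B] | a in A])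
       (ereal_sup [set ereal_inf [set (d a b)%:E | a in A] | b in B]).

Definition is_metric {Z : Type} (d : Z -> Z -> R) : Prop :=
  [/\ forall x y, 0 <= d x y,
      forall x y, d x y = 0 <-> x = y,
      forall x y, d x y = d y x &
      forall x y z, d x z <= d x y + d y z].

Definition isometric_on (X : normedModType R) {Z : Type} (d : Z -> Z -> R)
  (A : set X) (i : X -> Z) : Prop :=
  forall x x', A x -> A x' -> d (i x) (i x') = `|x - x'|.

Definition dGH (X Y : normedModType R) : \bar R :=
  ereal_inf [set h | exists (Z : Type) (d : Z -> Z -> R) (i : X -> Z) (j : Y -> Z),
     [/\ is_metric d, @isometric_on X Z d (unit_ball X) i,
         @isometric_on Y Z d (unit_ball Y) j &
         h = hausdorff d (i @` unit_ball X) (j @` unit_ball Y)]].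

Definition is_rnorm (r : R) (Z : lmodType R) (nZ : Z -> R) : Prop :=
  [/\ forall z, z != 0 -> 0 < nZ z,
      forall (a : R) z, nZ (a *: z) = `|a| * nZ z &
      forall z1 z2, nZ (z1 + z2) `^ r <= nZ z1 `^ r + nZ z2 `^ r].

Definition rnorm_complete (r : R) (Z : lmodType R) (nZ : Z -> R) : Prop :=
  forall u : nat -> Z,
    (forall e : R, 0 < e -> exists N : nat, forall m n : nat, (N <= m)%N -> (N <= n)%N ->
        nZ (u m - u n) `^ r < e) ->
    exists z : Z, forall e : R, 0 < e -> exists N : nat, forall n : nat, (N <= n)%N ->
        nZ (u n - z) `^ r < e.

Definition lin_isometry (X : normedModType R) (Z : lmodType R) (nZ : Z -> R)
  (T : X -> Z) : Prop :=
  (forall (a : R) (x y : X), T (a *: x + y) = a *: T x + T y) /\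
  (forall x : X, nZ (T x) = `|x|).

Definition d_r (r : R) (X Y : normedModType R) : \bar R :=
  ereal_inf [set h | exists (Z : lmodType R) (nZ : Z -> R) (T : X -> Z) (S : Y -> Z),
     [/\ is_rnorm r nZ, rnorm_complete r nZ, lin_isometry nZ T, lin_isometry nZ S &
         h = hausdorff (fun z1 z2 => nZ (z1 - z2)) (T @` unit_ball X) (S @` unit_ball Y)]].

End Defs.

(* Main.v *)
(* Lower bound: a Hausdorff distance [h] in an [r]-normed space gives a
   correspondence between the unit balls. Since [x1 - x2 = t u] with
   [t = `|x1 - x2|], the vector is within [t h] of some [t v] with [v] in the ball
   of [Y], so the distortion is at most [4 `^ (1/r) * h], and gluing the balls along
   the correspondence costs half of it.

   Upper bound: a correspondence of small distortion almost preserves midpoints,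
   by a quantitative Mazur-Ulam argument (iterated reflections double the defect,
   which stays bounded), hence it is almost homogeneous and almost additive. For
   [r < 1] the almost additivity passes to finite sums with an error controlled
   by the [l^r] norm of the coefficients. This is exactly what makes both
   embeddings into [X * Y] isometric for the largest [r]-norm in which
   corresponding points of the balls are [delta]-close. *)

Require Import Defs.
From HB Require Import structures.
From mathcomp Require Import all_boot all_order all_algebra.
From mathcomp Require Import all_classical all_reals all_analysis.
From mathcomp Require Import zify ring lra.
Import Order.TTheory GRing.Theory Num.Theory.
Import numFieldNormedType.Exports.
Set Implicit Arguments.
Unset Strict Implicit.
Unset Printing Implicit Defensive.
Local Open Scope classical_set_scope.
Local Open Scope ring_scope.

(** * Deciding linear identities in modules by reflection *)

Section LinearCombinations.
Variables (R : pzRingType) (V : lmodType R).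

Inductive lin_expr : Type :=
  | LinVar of nat
  | LinZero
  | LinAdd of lin_expr & lin_expr
  | LinOpp of lin_expr
  | LinScale of R & lin_expr.

Fixpoint lin_eval (env : seq V) (e : lin_expr) : V :=
  match e with
  | LinVar i => nth 0 env i
  | LinZero => 0
  | LinAdd e1 e2 => lin_eval env e1 + lin_eval env e2
  | LinOpp e1 => - lin_eval env e1
  | LinScale a e1 => a *: lin_eval env e1
  end.

(** [PeanoNat.Nat.eqb] computes on numerals under the [cbn] of [lin_eq], so that each coefficient
    becomes an explicit scalar expression. *)
Fixpoint lin_coef (i : nat) (e : lin_expr) : R :=
  match e with
  | LinVar j => if PeanoNat.Nat.eqb j i then 1 else 0
  | LinZero => 0
  | LinAdd e1 e2 => lin_coef i e1 + lin_coef i e2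
  | LinOpp e1 => - lin_coef i e1
  | LinScale a e1 => a * lin_coef i e1
  end.

Lemma lin_eval_sum env e :
  lin_eval env e = \sum_(i < size env) lin_coef i e *: env`_i.
Proof.
elim: e => [j||e1 IH1 e2 IH2|e1 IH1|a e1 IH1] /=.
- case: (ltnP j (size env)) => hj; last first.
    rewrite nth_default // big1 // => i _.
    case: PeanoNat.Nat.eqb_spec => [ji|_]; last by rewrite scale0r.
    by move: hj; rewrite ji leqNgt ltn_ord.
  rewrite (bigD1 (Ordinal hj)) //= PeanoNat.Nat.eqb_refl scale1r big1 ?addr0 //.
  move=> i ij; case: PeanoNat.Nat.eqb_spec => [ji|_]; last by rewrite scale0r.
  by move/eqP: ij; case; apply: val_inj.
- by rewrite big1 // => i _; rewrite scale0r.
- by rewrite IH1 IH2 -big_split; apply: eq_bigr => i _; rewrite scalerDl.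
- by rewrite IH1 -sumrN; apply: eq_bigr => i _; rewrite scaleNr.
- by rewrite IH1 scaler_sumr; apply: eq_bigr => i _; rewrite scalerA.
Qed.

(** A nested conjunction, not a quantifier over indices, so that [repeat split] leaves one scalar
    identity per atom. *)
Fixpoint lin_agree (n : nat) (e1 e2 : lin_expr) : Prop :=
  if n is m.+1 then lin_coef m e1 = lin_coef m e2 /\ lin_agree m e1 e2 else True.

Lemma lin_agree_eval env e1 e2 :
  lin_agree (size env) e1 e2 -> lin_eval env e1 = lin_eval env e2.
Proof.
move=> agree; rewrite !lin_eval_sum; apply: eq_bigr => i _; congr (_ *: _).
move: i; elim: (size env) agree => [_ []//|n IH [h hn] i].
have [->//|ni] := eqVneq (i : nat) n.
have hi : (i < n)%N by rewrite ltn_neqAle ni -ltnS ltn_ord.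
exact: (IH hn (Ordinal hi)).
Qed.

End LinearCombinations.

Ltac lin_index x env :=
  lazymatch env with
  | x :: _ => constr:(0%N)
  | _ :: ?env' => let n := lin_index x env' in constr:(n.+1)
  end.

(** In the last case [lin_index] fails on a new atom, and backtracking into the second branch adds
    it. *)
Ltac lin_atoms x env :=
  lazymatch x with
  | (?a + ?b)%R => let env1 := lin_atoms a env in lin_atoms b env1
  | (- ?a)%R => lin_atoms a env
  | (_ *: ?a)%R => lin_atoms a env
  | 0%R => env
  | _ => match env with
         | _ => let n := lin_index x env in env
         | _ => constr:(x :: env)
         end
  end.

Ltac lin_reify R x env :=
  lazymatch x with
  | (?a + ?b)%R =>
    let a' := lin_reify R a env in let b' := lin_reify R b env in
    constr:(@LinAdd R a' b')
  | (- ?a)%R => let a' := lin_reify R a env in constr:(@LinOpp R a')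
  | (?c *: ?a)%R => let a' := lin_reify R a env in constr:(@LinScale R c a')
  | 0%R => constr:(@LinZero R)
  | _ => let n := lin_index x env in constr:(@LinVar R n)
  end.

(* Proves equalities of linear combinations over a normed module, by comparing
   the coefficients of each atom. *)
Ltac lin_eq R V :=
  lazymatch goal with
  | |- ?x = ?y =>
    let env0 := constr:(@nil V) in
    let env1 := lin_atoms x env0 in
    let env := lin_atoms y env1 in
    let e1 := lin_reify R x env in
    let e2 := lin_reify R y env in
    refine (@lin_agree_eval R V env e1 e2 _);
    cbn [lin_agree lin_coef size PeanoNat.Nat.eqb];
    repeat split; first [ring | lra | field]
  end.

(** * Near-isometries and midpoints *)

Section NearMidpoint.
Variable R : realType.

(* Mazur-Ulam by the reflection trick: if [G] moves the midpoint [z] by [m],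
   then [psi o G^-1 o psi o G], with [psi] the reflection in [z], moves it by
   about [2 m], while all displacements stay bounded by about [`|a - b|]. *)
Lemma near_isometry_fixes_midpoint (X : normedModType R) (a b z : X) (k : nat) :
  z + z = a + b ->
  forall (s rho : R) (G : X -> X -> Prop),
  let near x := `|x - a| <= `|a - b| / 2 + rho /\ `|x - b| <= `|a - b| / 2 + rho in
  0 <= s -> (2 ^+ k - 1) * s <= rho ->
  (forall x, near x -> exists y, G x y) ->
  (forall y, near y -> exists x, G x y) ->
  (forall x y x' y', G x y -> G x' y' -> `| `|y - y'| - `|x - x'| | <= s) ->
  (forall x y, G x y ->
     `| `|y - a| - `|x - a| | <= s /\ `| `|y - b| - `|x - b| | <= s) ->
  forall y, G z y -> `|y - z| <= `|a - b| / 2 ^+ k + (1 + k%:R / 2) * s.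
Proof.
move=> zab.
have za : z - a = 2^-1 *: (b - a).
  have -> : z = 2^-1 *: (a + b) by rewrite -zab; lin_eq R X.
  by lin_eq R X.
have zb : z - b = 2^-1 *: (a - b).
  have -> : z = 2^-1 *: (a + b) by rewrite -zab; lin_eq R X.
  by lin_eq R X.
have nza : `|z - a| = `|a - b| / 2.
  by rewrite za normrZ distrC ger0_norm ?invr_ge0// mulrC.
have nzb : `|z - b| = `|a - b| / 2.
  by rewrite zb normrZ ger0_norm ?invr_ge0// mulrC.
have Dab := normr_ge0 (a - b).
elim: k => [|k IH] s rho G near s0 hrho dom ran iso fix_ab y Gzy.
  have [/ler_normlP [_ h] _] := fix_ab _ _ Gzy.
  have h2 := ler_distD a y z.
  rewrite (distrC a z) nza in h2; rewrite nza in h.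
  by rewrite expr0 mul0r addr0 mul1r divr1; lra.
have e2k : 1 <= (2 : R) ^+ k by rewrite exprn_ege1 // ler1n.
have rho_s : s <= rho.
  apply: le_trans hrho; rewrite exprS.
  have : 0 <= (2 ^+ k - 1) * s by rewrite mulr_ge0// subr_ge0.
  by lra.
have reflA u : a + b - u - a = - (u - b) by lin_eq R X.
have reflB u : a + b - u - b = - (u - a) by lin_eq R X.
have reflD u v : a + b - u - (a + b - v) = - (u - v) by lin_eq R X.
pose Gs x w := exists y0 u, [/\ G x y0, G u (a + b - y0) & w = a + b - u].
have nearz0 : near (a + b - y).
  have [/ler_normlP [_ h1] /ler_normlP [_ h2]] := fix_ab _ _ Gzy.
  by split; rewrite ?reflA ?reflB normrN; lra.
have [u Gu] := ran _ nearz0.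
have step x y0 u0 : G x y0 -> G u0 (a + b - y0) ->
    `| `|a + b - u0 - a| - `|x - a| | <= 2 * s /\
    `| `|a + b - u0 - b| - `|x - b| | <= 2 * s.
  move=> /fix_ab [/ler_normlP [h1 h2] /ler_normlP [h3 h4]].
  move=> /fix_ab; rewrite !reflA !reflB !normrN.
  move=> [/ler_normlP [h5 h6] /ler_normlP [h7 h8]].
  by split; apply/ler_normlP; split; lra.
have : `|a + b - u - z| <= `|a - b| / 2 ^+ k + (1 + k%:R / 2) * (2 * s).
  (* [Gs] uses [G] twice, whence the defect [2 * s]; a point within [rho - s] is moved to one within
     [rho], where [G] applies again. The budget fits as [(2 ^+ k.+1 - 1) * s - s = (2 ^+ k - 1) * (2
     * s)]. *)
  apply: (IH (2 * s) (rho - s) Gs).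
  - by lra.
  - by move: hrho; rewrite exprS; lra.
  - move=> x [xa xb].
    have [y0 Gxy0] : exists y0, G x y0 by apply: dom; split; lra.
    have [/ler_normlP [_ h1] /ler_normlP [_ h2]] := fix_ab _ _ Gxy0.
    have [u0 Gu0] : exists u0, G u0 (a + b - y0).
      by apply: ran; split; rewrite ?reflA ?reflB normrN; lra.
    by exists (a + b - u0), y0, u0.
  - move=> w [wa wb].
    have [y0 Gy0] : exists y0, G (a + b - w) y0.
      by apply: dom; split; rewrite ?reflA ?reflB normrN; lra.
    have [/ler_normlP [h0 h1] /ler_normlP [h3 h2]] := fix_ab _ _ Gy0.
    rewrite !reflA !reflB !normrN in h0 h1 h2 h3.
    have [x Gx] : exists x, G x (a + b - y0).
      by apply: ran; split; rewrite ?reflA ?reflB normrN; lra.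
    exists x, (a + b - y0), (a + b - w); split=> //; last by lin_eq R X.
    by have -> : a + b - (a + b - y0) = y0 by lin_eq R X.
  - move=> x w x' w' [y0 [u0 [G1 G2 ->]]] [y0' [u0' [G1' G2' ->]]].
    have /ler_normlP [h1 h2] := iso _ _ _ _ G1 G1'.
    have := iso _ _ _ _ G2 G2'; rewrite !reflD !normrN => /ler_normlP [h3 h4].
    by apply/ler_normlP; split; lra.
  - by move=> x w [y0 [u0 [G1 G2 ->]]]; exact: step G1 G2.
  - by exists y, u.
have -> : a + b - u - z = z - u by rewrite -zab; lin_eq R X.
(* The doubling: [z] and [u] have the images [y] and [a + b - y], which are [2 * |y - z|] apart, so
   [|z - u|] is at least this minus [s]. *)
have /ler_normlP [h1 h2] := iso _ _ _ _ Gzy Gu.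
have e1 : y - (a + b - y) = 2 *: (y - z) by rewrite -zab; lin_eq R X.
rewrite e1 normrZ ger0_norm // in h1 h2.
have -> : `|a - b| / 2 ^+ k.+1 = (`|a - b| / 2 ^+ k) / 2.
  by rewrite exprSr invfM mulrA.
rewrite -[k.+1%:R]natr1; lra.
Qed.

End NearMidpoint.

(** * Almost additivity of near-isometries between unit balls *)

Section NearIsometry.
Variable R : realType.
Implicit Types X Y : normedModType R.

(** A correspondence of distortion at most [eps]. Keeping it a relation makes it symmetric in [X]
    and [Y] and avoids choosing maps. *)
Definition near_isometry X Y (eps : R) (rel : X -> Y -> Prop) : Prop :=
  [/\ forall x y, rel x y -> `|x| <= 1 /\ `|y| <= 1,
      forall x, `|x| <= 1 -> exists y, rel x y,
      forall y, `|y| <= 1 -> exists x, rel x y &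
      forall x y x' y', rel x y -> rel x' y' ->
        `| `|y - y'| - `|x - x'| | <= eps].

Lemma near_isometry_sym X Y eps (rel : X -> Y -> Prop) :
  near_isometry eps rel -> near_isometry eps (fun y x => rel x y).
Proof.
move=> [ball dom ran iso]; split=> //.
  by move=> y x /ball [].
by move=> y x y' x' h h'; rewrite distrC; exact: iso.
Qed.

Lemma ler_normD2 X (x y : X) (A B : R) :
  `|x| <= A -> `|y| <= B -> `|x + y| <= A + B.
Proof. by move=> hx hy; apply: le_trans (ler_normD _ _) (lerD hx hy). Qed.

Lemma ler_normZ2 X (c : R) (x : X) (A : R) : `|x| <= A -> `|c *: x| <= `|c| * A.
Proof. by move=> hx; rewrite normrZ ler_wpM2l. Qed.

Lemma normZ_le1 X (c : R) (x : X) : `|c| <= 1 -> `|x| <= 1 -> `|c *: x| <= 1.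
Proof. by move=> hc hx; rewrite normrZ mulr_ile1. Qed.

(** The unit vector opposite to [y] is [1 + |y|] away from [y], while its partner in the ball of [X]
    is at most [1] away from [0]. *)
Lemma near_isometry_zero X Y eps (rel : X -> Y -> Prop) y :
  near_isometry eps rel -> rel 0 y -> `|y| <= eps.
Proof.
move=> [ball dom ran iso] h0.
have [->|y0] := eqVneq y 0.
  by have := iso _ _ _ _ h0 h0; rewrite !subrr !normr0; apply: le_trans.
have ny : 0 < `|y| by rewrite normr_gt0.
pose u := - (`|y|^-1 *: y).
have nu : `|u| = 1 by rewrite normrN normrZ normfV normr_id mulVf// gt_eqF.
have [x hx] : exists x, rel x u by apply: ran; rewrite nu.
have [xle _] := ball _ _ hx.
have /ler_normlP [_] := iso _ _ _ _ h0 hx; rewrite sub0r normrN.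
have -> : y - u = (1 + `|y|^-1) *: y by rewrite /u; lin_eq R Y.
rewrite normrZ ger0_norm ?addr_ge0// mulrDl mul1r mulVf ?gt_eqF//; lra.
Qed.

Lemma near_isometry_norm X Y eps (rel : X -> Y -> Prop) x y :
  near_isometry eps rel -> rel x y -> `|y| <= `|x| + 2 * eps.
Proof.
move=> iso hxy; have [ball dom ran dist] := iso.
have [y0 h0] : exists y0, rel 0 y0 by apply: dom; rewrite normr0.
have hy0 := near_isometry_zero iso h0.
have /ler_normlP [_] := dist _ _ _ _ hxy h0; rewrite subr0.
have := ler_distD y0 y 0; rewrite !subr0; lra.
Qed.

(** Go to [Y] by [rel], reflect in the midpoint of [a'] and [b'], come back and reflect in [z]. This
    almost fixes [a] and [b], with defect [2 * eps], so it almost fixes [z]; but it moves [z] by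
    about twice the distance from [z'] to the midpoint. *)
Lemma near_isometry_central_midpoint X Y eps (rel : X -> Y -> Prop) k a b z a' b' z' :
  near_isometry eps rel -> 0 <= eps ->
  (2 ^+ k - 1) * (2 * eps) + 3 * eps <= 1 / 2 ->
  z + z = a + b -> `|a| + `|a - b| / 2 <= 1 / 2 ->
  rel a a' -> rel b b' -> rel z z' ->
  `|z' - 2^-1 *: (a' + b')| <= 1 / 2 ^+ k + (k%:R + 5) * eps.
Proof.
move=> isom eps0 small zab central haa hbb hzz.
have [ball dom ran iso] := isom.
set rho := (2 ^+ k - 1) * (2 * eps) in small.
have na' := near_isometry_norm isom haa.
have na := normr_ge0 a.
have refl (V : normedModType R) (p q u : V) : `|p + q - u - p| = `|u - q|.
  by rewrite distrC; congr `|_|; lin_eq R V.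
have refr (V : normedModType R) (p q u : V) : `|p + q - u - q| = `|u - p|.
  by rewrite [p + q]addrC refl.
have refd (V : normedModType R) (p q u v : V) : `|p + q - u - (p + q - v)| = `|u - v|.
  by rewrite -normrN; congr `|_|; lin_eq R V.
pose near x := `|x - a| <= `|a - b| / 2 + rho /\ `|x - b| <= `|a - b| / 2 + rho.
have near_ball x : near x -> `|x| <= 1.
  by move=> [h _]; have := ler_distD a x 0; rewrite !subr0; lra.
have near_refl x : near x -> near (a + b - x).
  by move=> [h1 h2]; split; rewrite ?refl ?refr.
(* The reflected point has norm at most [|a'| + |y - b'|], hence at most [1 / 2 + rho + 3 * eps]:
   this is the origin of [3 * eps] in [small]. *)
have near_dom x y : near x -> rel x y -> exists v, rel v (a' + b' - y).
  move=> [xa xb] hxy; apply: ran.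
  have /ler_normlP [_ h] := iso _ _ _ _ hxy hbb.
  by have := ler_distD a' (a' + b' - y) 0; rewrite refl !subr0; lra.
pose G x w := exists y v, [/\ rel x y, rel v (a' + b' - y) & w = a + b - v].
have nearz : near z.
  have ez : z = 2^-1 *: (a + b) by rewrite -zab; lin_eq R X.
  have rho0 : 0 <= rho.
    by rewrite mulr_ge0 ?mulr_ge0// subr_ge0 exprn_ege1// ler1n.
  have e1 : `|z - a| = `|a - b| / 2.
    have -> : z - a = - (2^-1 *: (a - b)) by rewrite ez; lin_eq R X.
    by rewrite normrN normrZ ger0_norm ?invr_ge0// mulrC.
  have e2 : `|z - b| = `|a - b| / 2.
    have -> : z - b = 2^-1 *: (a - b) by rewrite ez; lin_eq R X.
    by rewrite normrZ ger0_norm ?invr_ge0// mulrC.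
  by split; rewrite ?e1 ?e2; lra.
have [v hv] := near_dom _ _ nearz hzz.
have : `|a + b - v - z| <= `|a - b| / 2 ^+ k + (1 + k%:R / 2) * (2 * eps).
  apply: (near_isometry_fixes_midpoint zab (rho := rho) (G := G)) => //.
  - by rewrite mulr_ge0.
  - move=> x xnear; have [y hxy] := dom _ (near_ball _ xnear).
    have [v0 hv0] := near_dom _ _ xnear hxy.
    by exists (a + b - v0), y, v0.
  - move=> w wnear; have [y hy] := dom _ (near_ball _ (near_refl _ wnear)).
    have [x hx] := near_dom _ _ (near_refl _ wnear) hy.
    exists x, (a' + b' - y), (a + b - w); split=> //; last by lin_eq R X.
    by have -> : a' + b' - (a' + b' - y) = y by lin_eq R Y.
  - move=> x w x' w' [y1 [v1 [r1 r2 ->]]] [y2 [v2 [r3 r4 ->]]].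
    have /ler_normlP [h1 h2] := iso _ _ _ _ r1 r3.
    have := iso _ _ _ _ r2 r4; rewrite !refd => /ler_normlP [h3 h4].
    by apply/ler_normlP; split; lra.
  - move=> x w [y1 [v1 [r1 r2 ->]]]; rewrite refl refr.
    have /ler_normlP [h1 h2] := iso _ _ _ _ r1 haa.
    have /ler_normlP [h3 h4] := iso _ _ _ _ r1 hbb.
    have := iso _ _ _ _ r2 haa; rewrite refl => /ler_normlP [h5 h6].
    have := iso _ _ _ _ r2 hbb; rewrite refr => /ler_normlP [h7 h8].
    by split; apply/ler_normlP; split; lra.
  - by exists z', v.
have -> : a + b - v - z = z - v by rewrite -zab; lin_eq R X.
have /ler_normlP [_] := iso _ _ _ _ hzz hv.
have -> : z' - (a' + b' - z') = 2 *: (z' - 2^-1 *: (a' + b')) by lin_eq R Y.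
rewrite normrZ ger0_norm // => h1 h2.
have h3 : `|a - b| / 2 ^+ k <= 1 / 2 ^+ k.
  by rewrite ler_wpM2r ?invr_ge0 ?exprn_ge0//; lra.
have : 0 <= k%:R * eps by rewrite mulr_ge0.
have : 0 <= 1 / 2 ^+ k :> R by rewrite divr_ge0 ?exprn_ge0.
lra.
Qed.

Definition midpoint_stable X Y (eta : R) (rel : X -> Y -> Prop) : Prop :=
  forall a b z a' b' z', z + z = a + b -> rel a a' -> rel b b' -> rel z z' ->
    `|z' - 2^-1 *: (a' + b')| <= eta.

(* Scaling by 1/4 moves an arbitrary pair into the region where the
   midpoints stay inside the ball. *)
Lemma near_isometry_midpoint X Y eps mu (rel : X -> Y -> Prop) k :
  near_isometry eps rel -> 0 <= eps ->
  (2 ^+ k - 1) * (2 * eps) + 3 * eps <= 1 / 2 ->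
  1 / 2 ^+ k + (k%:R + 5) * eps <= mu ->
  midpoint_stable (22 * mu) rel.
Proof.
move=> isom eps0 small hmu a b z a' b' z' zab haa hbb hzz.
have [ball dom ran iso] := isom.
have central := near_isometry_central_midpoint isom eps0 small.
have epsmu : eps <= mu.
  apply: le_trans hmu.
  have : 0 <= 1 / 2 ^+ k :> R by rewrite divr_ge0 ?exprn_ge0.
  have : 0 <= k%:R * eps by rewrite mulr_ge0.
  by lra.
have [w0 hw0] : exists w0, rel 0 w0 by apply: dom; rewrite normr0.
have norm_w0 := near_isometry_zero isom hw0.
(* With [0] as one endpoint, any [c] in the ball meets the centrality condition. *)
have half c d e : rel c d -> rel (2^-1 *: c) e -> `|e - 2^-1 *: d| <= 3 / 2 * mu.
  move=> hcd he; have [c1 _] := ball _ _ hcd.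
  have h : `|e - 2^-1 *: (w0 + d)| <= mu.
    apply: le_trans hmu; apply: central hw0 hcd he; first by lin_eq R X.
    by rewrite sub0r normrN normr0; lra.
  have -> : e - 2^-1 *: d = (e - 2^-1 *: (w0 + d)) + 2^-1 *: w0 by lin_eq R Y.
  apply: le_trans (ler_normD2 h (ler_normZ2 2^-1 norm_w0)) _.
  by rewrite ger0_norm ?invr_ge0//; lra.
have in_half (c : X) : `|c| <= 1 -> `|2^-1 *: c| <= 1.
  by move=> hc; rewrite normZ_le1// ger0_norm ?invr_ge0//; lra.
have quarter c d : rel c d ->
    exists2 g, rel (4^-1 *: c) g & `|g - 4^-1 *: d| <= 9 / 4 * mu.
  move=> hcd; have [c1 _] := ball _ _ hcd.
  have [e he] := dom _ (in_half _ c1).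
  have [g hg] := dom _ (in_half _ (in_half _ c1)).
  exists g; first by have -> : 4^-1 *: c = 2^-1 *: (2^-1 *: c) by lin_eq R X.
  have -> : g - 4^-1 *: d = (g - 2^-1 *: e) + 2^-1 *: (e - 2^-1 *: d) by lin_eq R Y.
  apply: le_trans (ler_normD2 (half _ _ _ he hg) (ler_normZ2 2^-1 (half _ _ _ hcd he))) _.
  by rewrite ger0_norm ?invr_ge0//; lra.
have [a4 ha ea] := quarter _ _ haa.
have [b4 hb eb] := quarter _ _ hbb.
have [z4 hz ez] := quarter _ _ hzz.
have h : `|z4 - 2^-1 *: (a4 + b4)| <= mu.
  apply: le_trans hmu; apply: central ha hb hz.
    by rewrite -!scalerDr zab.
  have [a1 _] := ball _ _ haa; have [b1 _] := ball _ _ hbb.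
  rewrite -scalerBr !normrZ (ger0_norm (_ : 0 <= 4^-1)) ?invr_ge0//.
  by have := ler_normB a b; lra.
(* The constant is [22 = 4 + 4 * (9 / 4) + 2 * (9 / 4 + 9 / 4)]. *)
have -> : z' - 2^-1 *: (a' + b') =
    4 *: (z4 - 2^-1 *: (a4 + b4)) + (- 4) *: (z4 - 4^-1 *: z')
    + 2 *: ((a4 - 4^-1 *: a') + (b4 - 4^-1 *: b')) by lin_eq R Y.
have := ler_normD2 (ler_normD2 (ler_normZ2 4 h) (ler_normZ2 (- 4) ez))
  (ler_normZ2 2 (ler_normD2 ea eb)).
rewrite normrN !ger0_norm// => H; apply: le_trans H _; lra.
Qed.

(** For [s] in [[0, 1]], bisect: [s *: c] is the midpoint of [0] and [(2 * s) *: c], or of [c] and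
    [(2 * s - 1) *: c]. Each bisection halves the earlier error. Negative [s] are reached through
    the midpoint [0] of [c] and [- c]. *)
Lemma midpoint_stable_scale X Y eta (rel : X -> Y -> Prop) s c d d' :
  near_isometry eta rel -> 0 < eta -> midpoint_stable eta rel ->
  `|s| <= 1 -> rel c d -> rel (s *: c) d' -> `|d' - s *: d| <= 8 * eta.
Proof.
move=> isom eta0 mid; have [ball dom ran iso] := isom.
have [w0 hw0] : exists w0, rel 0 w0 by apply: dom; rewrite normr0.
have norm_w0 := near_isometry_zero isom hw0.
(* [3 * eta] is the fixed point of the worse recursion, [x |-> eta + (eta + x) / 2]; the initial
   error [2] only uses that both points lie in the ball. *)
have pos n : forall t x y y', 0 <= t <= 1 -> rel x y -> rel (t *: x) y' ->
    `|y' - t *: y| <= 2 / 2 ^+ n + 3 * eta.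
  elim: n => [|n IH] t x y y' /andP[t0 t1] hxy hxy'.
    have [_ y1] := ball _ _ hxy; have [_ y1'] := ball _ _ hxy'.
    have := ler_normD2 y1' (ler_normZ2 (- t) y1).
    by rewrite normrN ger0_norm// scaleNr expr0; lra.
  have [x1 _] := ball _ _ hxy.
  have -> : 2 / 2 ^+ n.+1 = (2 / 2 ^+ n) / 2 :> R by rewrite exprSr invfM mulrA.
  have [t2|t2] := leP t (1 / 2).
    have [y2 h2] : exists y2, rel ((2 * t) *: x) y2.
      by apply: dom; apply: normZ_le1 => //; rewrite ger0_norm; lra.
    have t01 : 0 <= 2 * t <= 1 by apply/andP; split; lra.
    have e1 := IH _ _ _ _ t01 hxy h2.
    have e2 : `|y' - 2^-1 *: (w0 + y2)| <= eta.
      by apply: mid hw0 h2 hxy'; lin_eq R X.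
    have -> : y' - t *: y = (y' - 2^-1 *: (w0 + y2))
        + 2^-1 *: (w0 + (y2 - (2 * t) *: y)) by lin_eq R Y.
    apply: le_trans (ler_normD2 e2 (ler_normZ2 2^-1 (ler_normD2 norm_w0 e1))) _.
    by rewrite ger0_norm ?invr_ge0//; lra.
  have [y2 h2] : exists y2, rel ((2 * t - 1) *: x) y2.
    by apply: dom; apply: normZ_le1 => //; rewrite ger0_norm; lra.
  have t01 : 0 <= 2 * t - 1 <= 1 by apply/andP; split; lra.
  have e1 := IH _ _ _ _ t01 hxy h2.
  have e2 : `|y' - 2^-1 *: (y + y2)| <= eta.
    by apply: mid hxy h2 hxy'; lin_eq R X.
  have -> : y' - t *: y = (y' - 2^-1 *: (y + y2))
      + 2^-1 *: (y2 - (2 * t - 1) *: y) by lin_eq R Y.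
  apply: le_trans (ler_normD2 e2 (ler_normZ2 2^-1 e1)) _.
  by rewrite ger0_norm ?invr_ge0//; lra.
have [n hn] : exists n, 2 / 2 ^+ n <= eta.
  have [n _ hn] := near_infty_natSinv_expn_lt (PosNum (divr_gt0 eta0 (ltr0n R 2))).
  exists n; have /= := hn n (leqnn n).
  by rewrite -[X in X < _]mul1r ltr_pdivlMr//; lra.
have scale_pos t x y y' : 0 <= t <= 1 -> rel x y -> rel (t *: x) y' ->
    `|y' - t *: y| <= 4 * eta.
  by move=> t01 h1 h2; have := pos n _ _ _ _ t01 h1 h2; lra.
move=> s1 hcd hd'; have [s0|s0] := leP 0 s.
  have := scale_pos s _ _ _ _ hcd hd'; rewrite s0 -(ger0_norm s0) s1 => /(_ isT).
  by rewrite ger0_norm//; lra.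
have [c1 _] := ball _ _ hcd.
have [dm hdm] : exists dm, rel (- c) dm by apply: dom; rewrite normrN.
have e1 : `|d' - (- s) *: dm| <= 4 * eta.
  apply: scale_pos hdm _; last by have -> : - s *: - c = s *: c by lin_eq R X.
  by rewrite -(ltr0_norm s0) normr_ge0.
have e2 : `|w0 - 2^-1 *: (d + dm)| <= eta.
  by apply: mid hcd hdm hw0; lin_eq R X.
have -> : d' - s *: d = (d' - (- s) *: dm)
    + (2 * s) *: ((w0 - 2^-1 *: (d + dm)) + (- 1) *: w0) by lin_eq R Y.
apply: le_trans (ler_normD2 e1 (ler_normZ2 _ (ler_normD2 e2 (ler_normZ2 (- 1) norm_w0)))) _.
rewrite normrN1 normrM (ger0_norm (_ : 0 <= 2))// mul1r.
have : `|s| * (eta + eta) <= 1 * (eta + eta) by rewrite ler_wpM2r//; lra.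
lra.
Qed.

(** Three terms are what a sum cut at half its weight requires: two pieces and the entry at the
    cut. *)
Definition almost_additive3 X Y (eta : R) (rel : X -> Y -> Prop) : Prop :=
  forall s1 s2 s3 c c1 c2 c3 d d1 d2 d3,
  `|s1| <= 1 -> `|s2| <= 1 -> `|s3| <= 1 ->
  rel c d -> rel c1 d1 -> rel c2 d2 -> rel c3 d3 ->
  c = s1 *: c1 + s2 *: c2 + s3 *: c3 ->
  `|d - (s1 *: d1 + s2 *: d2 + s3 *: d3)| <= eta.

(** A quarter of [c] is the midpoint of [f]'s partner, halfway between the first two terms, and
    [g]'s partner, halfway between [0] and the third. Dividing by four keeps every intermediate
    point in the ball. *)
Lemma midpoint_stable_additive3 X Y eta (rel : X -> Y -> Prop) :
  near_isometry eta rel -> 0 < eta -> midpoint_stable eta rel ->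
  almost_additive3 (65 * eta) rel.
Proof.
move=> isom eta0 mid s1 s2 s3 c c1 c2 c3 d d1 d2 d3 s1_1 s2_1 s3_1 h h1 h2 h3 ec.
have [ball dom ran iso] := isom.
have scale := midpoint_stable_scale isom eta0 mid.
have [w0 hw0] : exists w0, rel 0 w0 by apply: dom; rewrite normr0.
have norm_w0 := near_isometry_zero isom hw0.
have [bc _] := ball _ _ h.
have [bc1 _] := ball _ _ h1; have [bc2 _] := ball _ _ h2; have [bc3 _] := ball _ _ h3.
have b1 := normZ_le1 s1_1 bc1; have b2 := normZ_le1 s2_1 bc2.
have b3 := normZ_le1 s3_1 bc3.
have [e1 r1] := dom _ b1; have [e2 r2] := dom _ b2; have [e3 r3] := dom _ b3.
have n1 := scale _ _ _ _ s1_1 h1 r1.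
have n2 := scale _ _ _ _ s2_1 h2 r2.
have n3 := scale _ _ _ _ s3_1 h3 r3.
have norm2V : `|2^-1 : R| = 2^-1 by rewrite ger0_norm ?invr_ge0.
have norm4V : `|4^-1 : R| = 4^-1 by rewrite ger0_norm ?invr_ge0.
have [f rf] : exists f, rel (2^-1 *: (s1 *: c1 + s2 *: c2)) f.
  apply: dom; have := ler_normZ2 2^-1 (ler_normD2 b1 b2).
  by rewrite norm2V; lra.
have [g rg] : exists g, rel (2^-1 *: (s3 *: c3)) g.
  by apply: dom; apply: normZ_le1 => //; rewrite norm2V; lra.
have norm4V1 : `|4^-1 : R| <= 1 by rewrite norm4V; lra.
have [k rk] := dom _ (normZ_le1 norm4V1 bc).
have nf : `|f - 2^-1 *: (e1 + e2)| <= eta by apply: mid r1 r2 rf; lin_eq R X.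
have ng : `|g - 2^-1 *: (w0 + e3)| <= eta by apply: mid hw0 r3 rg; lin_eq R X.
have nk : `|k - 2^-1 *: (f + g)| <= eta.
  by apply: mid rf rg rk; rewrite ec; lin_eq R X.
have nk' := scale _ _ _ _ norm4V1 h rk.
(* The errors add up to [4 * 8 + 4 + 2 + 2 + 1 + 3 * 8 = 65] times [eta]. *)
have -> : d - (s1 *: d1 + s2 *: d2 + s3 *: d3) =
    (- 4) *: (k - 4^-1 *: d) + 4 *: (k - 2^-1 *: (f + g))
    + 2 *: (f - 2^-1 *: (e1 + e2)) + 2 *: (g - 2^-1 *: (w0 + e3)) + w0
    + (e1 - s1 *: d1) + (e2 - s2 *: d2) + (e3 - s3 *: d3) by lin_eq R Y.
have := ler_normD2 (ler_normD2 (ler_normD2 (ler_normD2 (ler_normD2 (ler_normD2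
  (ler_normD2 (ler_normZ2 (- 4) nk') (ler_normZ2 4 nk)) (ler_normZ2 2 nf))
  (ler_normZ2 2 ng)) norm_w0) n1) n2) n3.
rewrite normrN !ger0_norm// => H; apply: le_trans H _; lra.
Qed.

Lemma near_isometry_additive3 (eta : R) : 0 < eta ->
  exists2 eps, 0 < eps <= eta & forall X Y (rel : X -> Y -> Prop),
    near_isometry eps rel -> almost_additive3 eta rel.
Proof.
move=> eta0; pose mu := eta / (65 * 22).
have mu0 : 0 < mu by rewrite divr_gt0.
have [k hk] : exists k, 1 / 2 ^+ k <= mu / 2.
  have [k _ hk] := near_infty_natSinv_expn_lt (PosNum (divr_gt0 mu0 (ltr0n R 2))).
  by exists k; exact: ltW (hk k (leqnn k)).
(* [k] is fixed first, to make [1 / 2 ^+ k] small. In [D], the terms [2 ^+ k * 4 + 6] leave room for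
   [k] reflections in the ball, and the last one gives [(k + 5) * eps <= mu / 2]. *)
pose D : R := 2 ^+ k * 4 + 6 + (k%:R + 5) * 2 / mu.
have e2k : 1 <= (2 : R) ^+ k by rewrite exprn_ege1 // ler1n.
have M0 : 0 <= (k%:R + 5) * 2 / mu by rewrite divr_ge0 ?mulr_ge0 ?addr_ge0// ltW.
have D0 : 0 < D by rewrite /D; lra.
pose eps := Num.min mu D^-1.
have eps0 : 0 < eps by rewrite lt_min mu0 invr_gt0.
have epsmu : eps <= mu by rewrite ge_min lexx.
have epsD : eps * D <= 1.
  by rewrite -ler_pdivlMr// mul1r ge_min lexx orbT.
have mueta : mu * (65 * 22) = eta by rewrite divfK.
exists eps; first by apply/andP; split=> //; lra.
move=> X Y rel isom.
have -> : eta = 65 * (22 * mu) by lra.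
have kmu : (k%:R + 5) * 2 / mu * mu = (k%:R + 5) * 2 by rewrite divfK// gt_eqF.
have p1 : 0 <= eps * 2 ^+ k by rewrite mulr_ge0 ?exprn_ge0// ltW.
have p2 : 0 <= eps * ((k%:R + 5) * 2 / mu) by rewrite mulr_ge0// ltW.
have epsk : (k%:R + 5) * eps <= mu / 2.
  have h : eps * ((k%:R + 5) * 2 / mu) <= 1 by move: epsD; rewrite /D; lra.
  have := ler_wpM2r (ltW mu0) h; rewrite -[eps * _ * mu]mulrA kmu; lra.
apply: midpoint_stable_additive3; last 1 first.
- apply: near_isometry_midpoint isom (ltW eps0) _ _; last by lra.
  by move: epsD; rewrite /D; lra.
- case: isom => ball dom ran iso; split=> // x y x' y' h h'.
  by apply: le_trans (iso _ _ _ _ h h') _; lra.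
- by lra.
Qed.

End NearIsometry.

(** * Finite sums *)

Section WeightedSums.
Variables (R : realType) (r : R).
Hypotheses (hr0 : 0 < r) (hr1 : r < 1).

Let hrV0 : 0 < r^-1. Proof. by rewrite invr_gt0. Qed.

Lemma powR_rootK (a : R) : 0 <= a -> (a `^ r) `^ r^-1 = a.
Proof. by move=> a0; rewrite -powRrM divff ?gt_eqF// powRr1. Qed.

Lemma root_powRK (a : R) : 0 <= a -> (a `^ r^-1) `^ r = a.
Proof. by move=> a0; rewrite -powRrM mulVf ?gt_eqF// powRr1. Qed.

Lemma ler_powR2 (p a b : R) : 0 <= p -> 0 <= a -> a <= b -> a `^ p <= b `^ p.
Proof.
by move=> p0 a0 ab; apply: ge0_ler_powR; rewrite ?nnegrE//; apply: le_trans ab.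
Qed.

Lemma ler_root (a b : R) : 0 <= a -> a <= b -> a `^ r^-1 <= b `^ r^-1.
Proof. exact: ler_powR2 (ltW hrV0). Qed.

(** A ratio [c / (a + b)] in [[0, 1]] is at most its [r]-th power; add this for [c = a] and
    [c = b]. *)
Lemma powR_subadd (a b : R) : 0 <= a -> 0 <= b -> (a + b) `^ r <= a `^ r + b `^ r.
Proof.
move=> a0 b0; have [s0|s0] := leP (a + b) 0.
  have -> : a = 0 by lra.
  have -> : b = 0 by lra.
  by rewrite addr0 powR0 ?gt_eqF// addr0.
have frac (c : R) : 0 <= c <= a + b -> c / (a + b) * (a + b) `^ r <= c `^ r.
  move=> /andP[c0 cs]; rewrite -{2}(divfK (lt0r_neq0 s0) c) powRM ?divr_ge0// ?(ltW s0)//.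
  rewrite ler_wpM2r ?powR_ge0//.
  have [->|cn0] := eqVneq c 0; first by rewrite mul0r powR_ge0.
  have c_gt0 : 0 < c by rewrite lt0r cn0.
  by rewrite ger1_powR ?(ltW hr1)// divr_gt0//= ler_pdivrMr// mul1r.
have ha : 0 <= a <= a + b by apply/andP; split; lra.
have hb : 0 <= b <= a + b by apply/andP; split; lra.
apply: le_trans; last exact: lerD (frac _ ha) (frac _ hb).
by rewrite -!mulrDl divff ?gt_eqF// mul1r.
Qed.

(** The entry [q] at which the running weight reaches [theta] is set apart from both pieces, since
    it may be too heavy for either. *)
Lemma split_at_weight (T : Type) (w : T -> R) (s : seq T) (theta : R) :
  (forall x, 0 <= w x) -> 0 < theta -> theta <= \sum_(x <- s) w x ->
  exists P q Q, [/\ s = P ++ q :: Q, \sum_(x <- P) w x <= theta &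
    \sum_(x <- Q) w x <= \sum_(x <- s) w x - theta].
Proof.
move=> w0; elim: s theta => [|x s IH] theta th0.
  by rewrite big_nil => /(lt_le_trans th0); rewrite ltxx.
rewrite big_cons => hth; have [h|h] := leP theta (w x).
  by exists [::], x, s; split=> //; rewrite ?big_nil; lra.
have [||P [q [Q [-> hP hQ]]]] := IH (theta - w x); try lra.
by exists (x :: P), q, Q; split; rewrite ?big_cons//; lra.
Qed.

Section Sums.
Variables X Y : normedModType R.
Implicit Type s : seq (R * (X * Y)).

(** An entry [(t, (x, y))] is a coefficient [t] with a pair of points; [weight] is the [r]-th power
    of the [l^r] quasi-norm of the coefficients. *)
Definition weight s := \sum_(q <- s) `|q.1| `^ r.
Definition lsum s := \sum_(q <- s) q.1 *: q.2.1.
Definition rsum s := \sum_(q <- s) q.1 *: q.2.2.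
Definition terms_in (rel : X -> Y -> Prop) s := {in s, forall q, rel q.2.1 q.2.2}.

Lemma weight_ge0 s : 0 <= weight s.
Proof. by apply: sumr_ge0 => q _; rewrite powR_ge0. Qed.

Lemma weight_cat s1 s2 : weight (s1 ++ s2) = weight s1 + weight s2.
Proof. exact: big_cat. Qed.

Lemma lsum_cat s1 s2 : lsum (s1 ++ s2) = lsum s1 + lsum s2.
Proof. exact: big_cat. Qed.

Lemma rsum_cat s1 s2 : rsum (s1 ++ s2) = rsum s1 + rsum s2.
Proof. exact: big_cat. Qed.

Lemma terms_in_cat rel s1 s2 :
  terms_in rel (s1 ++ s2) <-> terms_in rel s1 /\ terms_in rel s2.
Proof.
split=> [h|[h1 h2] q]; last by rewrite mem_cat => /orP[/h1|/h2].
by split=> q hq; apply: h; rewrite mem_cat hq ?orbT.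
Qed.

Lemma lsum_le_weight rel s : (forall x y, rel x y -> `|x| <= 1) ->
  terms_in rel s -> `|lsum s| `^ r <= weight s.
Proof.
move=> ball; rewrite /lsum /weight; elim: s => [|q s IH] hs.
  by rewrite !big_nil normr0 powR0 ?gt_eqF.
rewrite !big_cons; apply: (@le_trans _ _ ((`|q.1 *: q.2.1| + `|\sum_(q <- s) q.1 *: q.2.1|) `^ r)).
  by rewrite ler_powR2 ?ler_normD// ltW.
apply: le_trans (powR_subadd _ _) _ => //; apply: lerD; last first.
  by apply: IH => p ps; apply: hs; rewrite inE ps orbT.
apply: ler_powR2 => //; first exact: ltW.
by rewrite normrZ ler_piMr// (ball _ _ (hs q _))// mem_head.
Qed.

End Sums.

Section Swap.
Variables X Y : normedModType R.

Definition swap_terms (s : seq (R * (X * Y))) : seq (R * (Y * X)) :=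
  [seq (q.1, (q.2.2, q.2.1)) | q <- s].

Lemma weight_swap s : weight (swap_terms s) = weight s.
Proof. by rewrite /weight big_map. Qed.

Lemma lsum_swap s : lsum (swap_terms s) = rsum s.
Proof. by rewrite /lsum big_map. Qed.

Lemma rsum_swap s : rsum (swap_terms s) = lsum s.
Proof. by rewrite /rsum big_map. Qed.

Lemma terms_in_swap rel s :
  terms_in rel s -> terms_in (fun y x => rel x y) (swap_terms s).
Proof. by move=> h q /mapP[p /h hp ->]. Qed.

End Swap.

Lemma rsum_le_weight (X Y : normedModType R) (rel : X -> Y -> Prop) s :
  (forall x y, rel x y -> `|y| <= 1) -> terms_in rel s -> `|rsum s| `^ r <= weight s.
Proof.
move=> ball /terms_in_swap hs; rewrite -lsum_swap -weight_swap.
by apply: lsum_le_weight hs => y x; exact: ball.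
Qed.

(** Exactly the estimate that [gauge_coord_fst] and [gauge_coord_snd] use to make both embeddings
    isometric. *)
Definition sum_stable (X Y : normedModType R) (delta : R) (rel : X -> Y -> Prop) :=
  forall s, terms_in rel s ->
    `|rsum s| <= `|lsum s| + delta * weight s `^ r^-1 /\
    `|lsum s| <= `|rsum s| + delta * weight s `^ r^-1.

(* Cutting a sum at half its weight leaves two pieces whose [l^r] norms are each
   at most [2^(-1/r)] times the total; as [2 * 2^(-1/r) < 1], the errors of the
   pieces and of one recombination are absorbed. *)
Lemma almost_additive_sum (X Y : normedModType R) (rel : X -> Y -> Prop) (eta K : R) :
  (forall x y, rel x y -> `|x| <= 1 /\ `|y| <= 1) ->
  (forall x, `|x| <= 1 -> exists y, rel x y) ->
  almost_additive3 eta rel -> eta + K * (2 * 2^-1 `^ r^-1) <= K -> 0 <= K ->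
  forall s c d, terms_in rel s -> rel c d -> weight s `^ r^-1 *: c = lsum s ->
    `|weight s `^ r^-1 *: d - rsum s| <= K * weight s `^ r^-1.
Proof.
move=> ball dom add3 hK K0 s.
have [n] := ubnP (size s); elim: n s => // n IH s /ltnSE sn c d hs hcd.
set S := weight s `^ r^-1 => hc.
have ballr x y : rel x y -> `|y| <= 1 by case/ball.
have balll x y : rel x y -> `|x| <= 1 by case/ball.
have lsum_root t : terms_in rel t -> `|lsum t| <= weight t `^ r^-1.
  move=> ht; rewrite -[leLHS]powR_rootK// ler_root ?powR_ge0//.
  exact: lsum_le_weight ht.
have rsum_root t : terms_in rel t -> `|rsum t| <= weight t `^ r^-1.
  move=> ht; rewrite -[leLHS]powR_rootK// ler_root ?powR_ge0//.
  exact: rsum_le_weight ht.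
have [W0|Wn0] := eqVneq (weight s) 0.
  have S0 : S = 0 by rewrite /S W0 powR0// gt_eqF.
  have := rsum_root _ hs; rewrite -/S S0 normr_le0 => /eqP ->.
  by rewrite scale0r subr0 normr0 mulr0.
have W0 : 0 < weight s by rewrite lt0r Wn0 weight_ge0.
have S0 : 0 < S by rewrite powR_gt0.
have [|||P [q [Q [es hP hQ]]]] := @split_at_weight _ (fun q => `|q.1| `^ r) s (weight s / 2).
- by move=> x; rewrite powR_ge0.
- by rewrite divr_gt0.
- by have := weight_ge0 s; rewrite -/(weight s); lra.
have {}hP : weight P <= weight s / 2 by [].
have {}hQ : weight Q <= weight s / 2.
  by move: hQ; rewrite -/(weight s) -/(weight Q); lra.
have hs' := hs; rewrite es in hs'; case/terms_in_cat: hs' => tP tqQ.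
have tq : rel q.2.1 q.2.2 by apply: tqQ; rewrite mem_head.
have tQ : terms_in rel Q by move=> p pQ; apply: tqQ; rewrite inE pQ orbT.
have half (t : seq (R * (X * Y))) : weight t <= weight s / 2 -> weight t `^ r^-1 <= 2^-1 `^ r^-1 * S.
  move=> ht; rewrite -powRM ?invr_ge0 ?weight_ge0// ler_root ?weight_ge0//.
  by rewrite mulrC.
have half1 : 2^-1 `^ r^-1 <= 1 :> R.
  have := @ler_powR2 r^-1 2^-1 1; rewrite powR1 => -> //; first exact: ltW.
  by lra.
have small (t : seq (R * (X * Y))) : weight t <= weight s / 2 -> `|weight t `^ r^-1 / S| <= 1.
  move=> ht; rewrite ger0_norm ?divr_ge0 ?powR_ge0 ?(ltW S0)// ler_pdivrMr// mul1r.
  by apply: le_trans (half _ ht) _; rewrite ler_piMl// ltW.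
have qS : `|q.1 / S| <= 1.
  rewrite normrM normfV (gtr0_norm S0) ler_pdivrMr// mul1r -[leLHS]powR_rootK//.
  rewrite ler_root ?powR_ge0// es weight_cat /weight big_cons.
  rewrite addrCA lerDl addr_ge0//; exact: weight_ge0.
(* At weight [0] the convention [0^-1 = 0] gives the vector [0], which is still correct because then
   [lsum t = 0]. *)
have unit t : terms_in rel t -> `|(weight t `^ r^-1)^-1 *: lsum t| <= 1 /\
    weight t `^ r^-1 *: ((weight t `^ r^-1)^-1 *: lsum t) = lsum t.
  move=> ht; have := lsum_root _ ht; have := powR_ge0 (weight t) r^-1.
  move: (weight t `^ r^-1) => w w0 hw; have [wz|wn] := eqVneq w 0.
    move: hw; rewrite wz normr_le0 => /eqP ->.
    by rewrite scale0r scaler0 normr0.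
  have w_gt0 : 0 < w by rewrite lt0r wn.
  rewrite normrZ normfV gtr0_norm// scalerA divff// scale1r; split=> //.
  by rewrite mulrC ler_pdivrMr// mul1r.
have [uP eP] := unit _ tP; have [uQ eQ] := unit _ tQ.
have [dP hdP] := dom _ uP; have [dQ hdQ] := dom _ uQ.
have sizes : (size P < n)%N /\ (size Q < n)%N.
  by move: sn; rewrite es size_cat /=; lia.
have errP := IH _ sizes.1 _ _ tP hdP eP.
have errQ := IH _ sizes.2 _ _ tQ hdQ eQ.
have e3 : lsum s = lsum P + (q.1 *: q.2.1 + lsum Q).
  by rewrite es lsum_cat {2}/lsum big_cons.
have e4 : rsum s = rsum P + (q.1 *: q.2.2 + rsum Q).
  by rewrite es rsum_cat {2}/rsum big_cons.
have cancel (u : R) : u = S * (u / S) by rewrite mulrCA divff ?gt_eqF// mulr1.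
(* After division by [S], [c] combines the normalised sums of [P] and [Q] with the entry [q], all
   coefficients being at most [1] in absolute value. *)
have err := add3 _ _ _ c _ _ _ d dP _ dQ (small _ hP) qS (small _ hQ) hcd hdP tq hdQ.
have {}err : `|d - (weight P `^ r^-1 / S *: dP + q.1 / S *: q.2.2 +
    weight Q `^ r^-1 / S *: dQ)| <= eta.
  apply: err.
  rewrite ![_ / S]mulrC -!scalerA eP eQ -[LHS]scale1r -(mulVf (lt0r_neq0 S0)).
  by rewrite -scalerA hc e3 -!scalerDr addrA.
have -> : S *: d - rsum s =
    S *: (d - (weight P `^ r^-1 / S *: dP + q.1 / S *: q.2.2 + weight Q `^ r^-1 / S *: dQ))
    + (weight P `^ r^-1 *: dP - rsum P) + (weight Q `^ r^-1 *: dQ - rsum Q).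
  rewrite e4 {2}(cancel (weight P `^ r^-1)) {2}(cancel (weight Q `^ r^-1)) {1}(cancel q.1).
  by lin_eq R Y.
apply: le_trans (ler_normD2 (ler_normD2 (ler_normZ2 S err) errP) errQ) _.
rewrite gtr0_norm//.
have := ler_wpM2l K0 (half _ hP); have := ler_wpM2l K0 (half _ hQ).
have := ler_wpM2r (ltW S0) hK.
lra.
Qed.

Lemma near_isometry_sum_stable (delta : R) : 0 < delta ->
  exists2 eps, 0 < eps & forall (X Y : normedModType R) (rel : X -> Y -> Prop),
    near_isometry eps rel -> sum_stable delta rel.
Proof.
move=> delta0.
have theta0 : 0 < 1 - 2 * 2^-1 `^ r^-1 :> R.
  (* [2 * 2^(-1/r)] equals [(1/2)^(1/r - 1)], whose exponent is positive as [r < 1]. *)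
  rewrite -mulr_powRB1 ?invr_ge0// mulrA divff// mul1r subr_gt0.
  have := @gt0_ltr_powR R (r^-1 - 1); rewrite subr_gt0 invf_gt1// => /(_ hr1).
  move=> /(_ 2^-1 1); rewrite !nnegrE powR1; apply=> //; lra.
(* Half of [delta] pays for [almost_additive_sum]; the other half pays for the [2 * eps] of
   [near_isometry_norm], hence [delta / 4] in [eta]. *)
pose K := delta / 2.
have K0 : 0 < K by rewrite divr_gt0.
pose eta := Num.min (K * (1 - 2 * 2^-1 `^ r^-1)) (delta / 4).
have eta0 : 0 < eta by rewrite lt_min mulr_gt0// divr_gt0.
have etaK : eta <= K * (1 - 2 * 2^-1 `^ r^-1) by rewrite ge_min lexx.
have eta4 : eta <= delta / 4 by rewrite ge_min lexx orbT.
have [eps /andP[eps0 epseta] add3] := near_isometry_additive3 eta0.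
exists eps => //.
have one_sided (X Y : normedModType R) (rel : X -> Y -> Prop) s :
    near_isometry eps rel -> terms_in rel s ->
    `|rsum s| <= `|lsum s| + delta * weight s `^ r^-1.
  move=> isom hs; have [ball dom _ _] := isom.
  have hK : eta + K * (2 * 2^-1 `^ r^-1) <= K by lra.
  have sums := almost_additive_sum ball dom (add3 _ _ _ isom) hK (ltW K0).
  have S0 := powR_ge0 (weight s) r^-1.
  have ballr x y : rel x y -> `|y| <= 1 by case/ball.
  have balll x y : rel x y -> `|x| <= 1 by case/ball.
  have hl : `|lsum s| <= weight s `^ r^-1.
    rewrite -[leLHS]powR_rootK// ler_root ?powR_ge0//.
    exact: lsum_le_weight hs.
  have [Sz|Sn] := eqVneq (weight s `^ r^-1) 0.
    suff -> : rsum s = 0 by rewrite normr0 addr_ge0// mulr_ge0// ltW.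
    apply/eqP; rewrite -normr_le0 -Sz -[leLHS]powR_rootK//.
    rewrite ler_root ?powR_ge0//; exact: rsum_le_weight hs.
  have S_gt0 : 0 < weight s `^ r^-1 by rewrite lt0r Sn.
  have [d hd] : exists d, rel ((weight s `^ r^-1)^-1 *: lsum s) d.
    apply: dom; rewrite normrZ normfV gtr0_norm// mulrC.
    by rewrite ler_pdivrMr// mul1r.
  have hS : weight s `^ r^-1 *: ((weight s `^ r^-1)^-1 *: lsum s) = lsum s.
    by rewrite scalerA divff// scale1r.
  have err := sums _ _ _ hs hd hS.
  have nd := ler_wpM2l S0 (near_isometry_norm isom hd).
  rewrite mulrDr -{1}(gtr0_norm S_gt0) -normrZ -{2}(gtr0_norm S_gt0) -normrZ hS in nd.
  have := ler_distD (weight s `^ r^-1 *: d) (rsum s) 0.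
  rewrite !subr0 distrC.
  have := ler_wpM2l S0 epseta; have := ler_wpM2l S0 eta4.
  by move: err nd; rewrite /K; lra.
move=> X Y rel isom s hs; split; first exact: one_sided isom hs.
have := one_sided _ _ _ _ (near_isometry_sym isom) (terms_in_swap hs).
by rewrite rsum_swap lsum_swap weight_swap.
Qed.

(** Both sums are already bounded by the [l^r] quasi-norm of the coefficients. This yields the a
    priori bound [d_r <= 1]. *)
Lemma sum_stable1 (X Y : normedModType R) (rel : X -> Y -> Prop) :
  (forall x y, rel x y -> `|x| <= 1 /\ `|y| <= 1) -> sum_stable 1 rel.
Proof.
move=> ball s hs.
have hl : `|lsum s| <= weight s `^ r^-1.
  rewrite -[leLHS]powR_rootK// ler_root ?powR_ge0//.
  by apply: lsum_le_weight hs => x y /ball[].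
have hr : `|rsum s| <= weight s `^ r^-1.
  rewrite -[leLHS]powR_rootK// ler_root ?powR_ge0//.
  by apply: rsum_le_weight hs => x y /ball[].
by rewrite mul1r; split; apply: le_trans (_ : weight s `^ r^-1 <= _); rewrite ?lerDr.
Qed.

End WeightedSums.

(** * The r-norm on the product *)

Section Gauge.
Variables (R : realType) (r : R).
Hypotheses (hr0 : 0 < r) (hr1 : r < 1).
Variables (X Y : normedModType R) (delta : R) (rel : X -> Y -> Prop).
Hypotheses (delta0 : 0 < delta) (delta1 : delta <= 1).
Hypothesis ball : forall x y, rel x y -> `|x| <= 1 /\ `|y| <= 1.
Hypothesis stable : sum_stable r delta rel.

Let Z : lmodType R := (X * Y)%type.
Implicit Types (z : Z) (s : seq (R * (X * Y))).

(** The list writes [z] as a combination of vectors [(x, - y)], each priced [delta], plus a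
    remainder priced coordinatewise; the sign in [(x, - y)] explains the [+] before [rsum s]. *)
Definition gauge_cost z s : R :=
  `|z.1 - lsum s| `^ r + `|z.2 + rsum s| `^ r + delta `^ r * weight r s.

(* The [r]-th power of the largest [r]-norm for which the two coordinate
   embeddings are contractive and [(x, - y)] has norm at most [delta] whenever
   [rel x y]. *)
Definition gauge_pow z : R :=
  inf [set x | exists2 s, terms_in rel s & x = gauge_cost z s].

Definition gauge z : R := gauge_pow z `^ r^-1.

Lemma gauge_cost_ge0 z s : 0 <= gauge_cost z s.
Proof.
by rewrite /gauge_cost !addr_ge0 ?powR_ge0// mulr_ge0 ?powR_ge0// weight_ge0.
Qed.

Lemma terms_in_nil : terms_in rel [::].
Proof. by []. Qed.

Lemma gauge_pow_le z s : terms_in rel s -> gauge_pow z <= gauge_cost z s.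
Proof.
move=> hs; apply: ge_inf; last by exists s.
by exists 0 => _ [t _ ->]; exact: gauge_cost_ge0.
Qed.

Lemma gauge_pow_ge z (m : R) :
  (forall s, terms_in rel s -> m <= gauge_cost z s) -> m <= gauge_pow z.
Proof.
move=> h; apply: lb_le_inf => [|_ [s hs ->]]; last exact: h.
by exists (gauge_cost z [::]), [::].
Qed.

Lemma gauge_pow_ge0 z : 0 <= gauge_pow z.
Proof. by apply: gauge_pow_ge => s _; exact: gauge_cost_ge0. Qed.

Lemma gauge_powr z : gauge z `^ r = gauge_pow z.
Proof. by rewrite /gauge root_powRK// gauge_pow_ge0. Qed.

Lemma powR_ler_normD (V : normedModType R) (u v : V) :
  `|u + v| `^ r <= `|u| `^ r + `|v| `^ r.
Proof.
apply: le_trans (powR_subadd hr0 hr1 _ _) => //.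
by apply: ler_powR2; rewrite ?ler_normD// ltW.
Qed.

Lemma gauge_pow_triangle z1 z2 : gauge_pow (z1 + z2) <= gauge_pow z1 + gauge_pow z2.
Proof.
rewrite -lerBlDr; apply: gauge_pow_ge => s1 h1.
rewrite lerBlDr -lerBlDl; apply: gauge_pow_ge => s2 h2.
rewrite lerBlDl; apply: le_trans (gauge_pow_le _ (_ : terms_in rel (s1 ++ s2))) _.
  by apply/terms_in_cat.
rewrite /gauge_cost weight_cat lsum_cat rsum_cat /= mulrDr.
have -> : z1.1 + z2.1 - (lsum s1 + lsum s2) = (z1.1 - lsum s1) + (z2.1 - lsum s2).
  by lin_eq R X.
have -> : z1.2 + z2.2 + (rsum s1 + rsum s2) = (z1.2 + rsum s1) + (z2.2 + rsum s2).
  by lin_eq R Y.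
have := powR_ler_normD (z1.1 - lsum s1) (z2.1 - lsum s2).
have := powR_ler_normD (z1.2 + rsum s1) (z2.2 + rsum s2).
lra.
Qed.

Lemma gauge_powZ_le (a : R) z : a != 0 -> gauge_pow (a *: z) <= `|a| `^ r * gauge_pow z.
Proof.
move=> a0; have na : 0 < `|a| by rewrite normr_gt0.
rewrite -ler_pdivrMl ?powR_gt0//; apply: gauge_pow_ge => s hs.
rewrite ler_pdivrMl ?powR_gt0//.
pose sa := [seq (a * q.1, q.2) | q <- s].
apply: le_trans (gauge_pow_le _ (_ : terms_in rel sa)) _.
  by move=> q /mapP[p /hs hp ->].
have -> : gauge_cost (a *: z) sa = `|a| `^ r * gauge_cost z s; last by [].
rewrite /gauge_cost.
have -> : lsum sa = a *: lsum s.
  by rewrite /lsum big_map scaler_sumr; apply: eq_bigr => q _; rewrite scalerA.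
have -> : rsum sa = a *: rsum s.
  by rewrite /rsum big_map scaler_sumr; apply: eq_bigr => q _; rewrite scalerA.
have -> : weight r sa = `|a| `^ r * weight r s.
  rewrite /weight big_map mulr_sumr; apply: eq_bigr => q _.
  by rewrite normrM powRM.
rewrite /= -scalerBr -scalerDr !normrZ !powRM//; ring.
Qed.

Lemma gauge_pow0 : gauge_pow 0 = 0.
Proof.
apply/eqP; rewrite eq_le gauge_pow_ge0 andbT.
apply: le_trans (gauge_pow_le _ terms_in_nil) _.
by rewrite /gauge_cost /lsum /rsum /weight !big_nil /= subr0 addr0 !normr0
  powR0 ?gt_eqF// mulr0 !addr0.
Qed.

Lemma gauge_powZ (a : R) z : gauge_pow (a *: z) = `|a| `^ r * gauge_pow z.
Proof.
have [->|a0] := eqVneq a 0.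
  by rewrite scale0r gauge_pow0 normr0 powR0 ?gt_eqF// mul0r.
apply/eqP; rewrite eq_le gauge_powZ_le//=.
have na : 0 < `|a| by rewrite normr_gt0.
rewrite -ler_pdivlMl ?powR_gt0//.
have := @gauge_powZ_le a^-1 (a *: z); rewrite invr_eq0 => /(_ a0).
by rewrite scalerA mulVf// scale1r normfV -[`|a|^-1]powR_inv1// -powRrM mulN1r powRN.
Qed.

(** [|lsum s|] to the power [r] is at most the weight, and [delta <= 1] lets the price of the
    remainder be lowered to [delta] too. Definiteness and completeness rest on this bound. *)
Lemma gauge_pow_fst z : delta `^ r * `|z.1| `^ r <= gauge_pow z.
Proof.
apply: gauge_pow_ge => s hs.
have d1 : delta `^ r <= 1.
  by have := @ler_powR2 R r delta 1; rewrite powR1; apply=> //; exact: ltW.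
have hl : `|lsum s| `^ r <= weight r s.
  by apply: lsum_le_weight hs => // x y /ball[].
have := powR_ler_normD (z.1 - lsum s) (lsum s); rewrite subrK => h.
have := ler_wpM2l (powR_ge0 delta r) (le_trans h (lerD (lexx _) hl)).
have := ler_wpM2r (powR_ge0 `|z.1 - lsum s| r) d1.
have := powR_ge0 `|z.2 + rsum s| r.
rewrite /gauge_cost; lra.
Qed.

Lemma gauge_pow_snd z : delta `^ r * `|z.2| `^ r <= gauge_pow z.
Proof.
apply: gauge_pow_ge => s hs.
have d1 : delta `^ r <= 1.
  by have := @ler_powR2 R r delta 1; rewrite powR1; apply=> //; exact: ltW.
have hl : `|- rsum s| `^ r <= weight r s.
  by rewrite normrN; apply: rsum_le_weight hs => // x y /ball[].
have := powR_ler_normD (z.2 + rsum s) (- rsum s); rewrite addrK => h.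
have := ler_wpM2l (powR_ge0 delta r) (le_trans h (lerD (lexx _) hl)).
have := ler_wpM2r (powR_ge0 `|z.2 + rsum s| r) d1.
have := powR_ge0 `|z.1 - lsum s| r.
rewrite /gauge_cost; lra.
Qed.

Lemma gauge_pow_norms z : gauge_pow z <= `|z.1| `^ r + `|z.2| `^ r.
Proof.
apply: le_trans (gauge_pow_le _ terms_in_nil) _.
by rewrite /gauge_cost /lsum /rsum /weight !big_nil subr0 addr0 mulr0 addr0.
Qed.

Lemma gauge_is_rnorm : is_rnorm r gauge.
Proof.
split=> [z z0|a z|z1 z2].
- apply: powR_gt0.
  have dr : 0 < delta `^ r by exact: powR_gt0.
  have [z10|z1n] := eqVneq z.1 0; last first.
    apply: lt_le_trans (gauge_pow_fst z).
    by rewrite mulr_gt0// powR_gt0// normr_gt0.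
  apply: lt_le_trans (gauge_pow_snd z).
  rewrite mulr_gt0// powR_gt0// normr_gt0; apply: contra z0 => /eqP z20.
  by case: z z10 z20 => ? ? /= -> ->.
- by rewrite /gauge gauge_powZ powRM ?powR_ge0 ?gauge_pow_ge0// powR_rootK.
- rewrite [leLHS]gauge_powr [X in _ <= X + _]gauge_powr [X in _ <= _ + X]gauge_powr.
  exact: gauge_pow_triangle.
Qed.

(** The empty list gives the upper bound. For the lower one, the second remainder is [rsum s], and
    by stability its price together with that of the list covers [|lsum s|], so no detour through
    [Y] is a shortcut. *)
Lemma gauge_coord_fst x : gauge ((x, 0) : Z) = `|x|.
Proof.
rewrite /gauge; suff -> : gauge_pow ((x, 0) : Z) = `|x| `^ r by rewrite powR_rootK.
apply/eqP; rewrite eq_le; apply/andP; split.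
  by apply: le_trans (gauge_pow_norms _) _; rewrite /= normr0 powR0 ?gt_eqF// addr0.
apply: gauge_pow_ge => s hs; rewrite /gauge_cost /= add0r.
have [_ h] := stable hs.
have w0 := weight_ge0 r s.
have h1 : `|lsum s| `^ r <= `|rsum s| `^ r + delta `^ r * weight r s.
  apply: le_trans (ler_powR2 (ltW hr0) (normr_ge0 _) h) _.
  apply: le_trans (powR_subadd hr0 hr1 _ _) _ => //.
    by rewrite mulr_ge0 ?powR_ge0// ltW.
  by rewrite powRM ?powR_ge0 ?(ltW delta0)// root_powRK.
have := powR_ler_normD (x - lsum s) (lsum s); rewrite subrK; lra.
Qed.

Lemma gauge_coord_snd y : gauge ((0, y) : Z) = `|y|.
Proof.
rewrite /gauge; suff -> : gauge_pow ((0, y) : Z) = `|y| `^ r by rewrite powR_rootK.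
apply/eqP; rewrite eq_le; apply/andP; split.
  by apply: le_trans (gauge_pow_norms _) _; rewrite /= normr0 powR0 ?gt_eqF// add0r.
apply: gauge_pow_ge => s hs; rewrite /gauge_cost /= sub0r normrN.
have [h _] := stable hs.
have w0 := weight_ge0 r s.
have h1 : `|- rsum s| `^ r <= `|lsum s| `^ r + delta `^ r * weight r s.
  rewrite normrN; apply: le_trans (ler_powR2 (ltW hr0) (normr_ge0 _) h) _.
  apply: le_trans (powR_subadd hr0 hr1 _ _) _ => //.
    by rewrite mulr_ge0 ?powR_ge0// ltW.
  by rewrite powRM ?powR_ge0 ?(ltW delta0)// root_powRK.
have := powR_ler_normD (y + rsum s) (- rsum s); rewrite addrK; lra.
Qed.

Lemma gauge_pair_le x y : rel x y -> gauge ((x, - y) : Z) <= delta.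
Proof.
move=> hxy; rewrite -[leRHS](powR_rootK hr0) ?(ltW delta0)// ler_root// ?gauge_pow_ge0//.
have hs : terms_in rel [:: (1, (x, y))] by move=> q; rewrite inE => /eqP ->.
apply: le_trans (gauge_pow_le _ hs) _.
rewrite /gauge_cost /lsum /rsum /weight !big_seq1 /= !scale1r subrr addNr.
by rewrite !normr0 normr1 powR1 powR0 ?gt_eqF// mulr1 !add0r.
Qed.

End Gauge.

(** * Completeness of the gauge and the resulting bound on [d_r] *)

Section Completeness.
Variables (R : realType) (r : R).
Hypotheses (hr0 : 0 < r) (hr1 : r < 1).

Lemma norm_cauchy_limit (V : completeNormedModType R) (u : nat -> V) :
  (forall e : R, 0 < e -> exists N : nat, forall m n : nat,
     (N <= m)%N -> (N <= n)%N -> `|u m - u n| < e) ->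
  exists l : V, forall e : R, 0 < e -> exists N : nat, forall n : nat,
     (N <= n)%N -> `|u n - l| < e.
Proof.
move=> hu.
have /cauchy_cvgP/cvg_ex[l ul] : cauchy (u @ \oo).
  apply: cauchy_exP => e e0; have [N hN] := hu _ e0.
  by exists (u N), N => // n /= Nn; rewrite -ball_normE; exact: hN.
exists l => e e0; move/cvgrPdist_lt: ul => /(_ _ e0) [N _ hN].
by exists N => n /hN; rewrite /= distrC.
Qed.

(** The gauge is equivalent to the coordinate norms: [gauge_pow_fst] and [gauge_pow_snd] make the
    coordinates Cauchy, and [gauge_pow_norms] brings their limits back. *)
Lemma gauge_complete (X Y : completeNormedModType R) (delta : R) (rel : X -> Y -> Prop) :
  0 < delta -> delta <= 1 ->
  (forall x y, rel x y -> `|x| <= 1 /\ `|y| <= 1) -> sum_stable r delta rel ->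
  rnorm_complete r (gauge r delta rel).
Proof.
move=> delta0 delta1 ball stable u hu.
have dr : 0 < delta `^ r by exact: powR_gt0.
have coord (V : completeNormedModType R) (p : X * Y -> V) :
    (forall m n, delta `^ r * `|p (u m) - p (u n)| `^ r <=
       gauge_pow r delta rel (u m - u n)) ->
    exists l : V, forall e : R, 0 < e -> exists N : nat, forall n : nat,
      (N <= n)%N -> `|p (u n) - l| < e.
  move=> hp; apply: norm_cauchy_limit => e e0.
  have [N hN] := hu (delta `^ r * e `^ r) (mulr_gt0 dr (powR_gt0 _ e0)).
  exists N => m n hm hn; have := hN _ _ hm hn; rewrite gauge_powr//.
  move=> /(le_lt_trans (hp m n)); rewrite ltr_pM2l// => h.
  rewrite ltNge; apply/negP => /(ler_powR2 (ltW hr0) (ltW e0)).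
  by rewrite leNgt h.
have [l1 h1] := coord X fst (fun m n => gauge_pow_fst hr0 hr1 delta0 delta1 ball (u m - u n)).
have [l2 h2] := coord Y snd (fun m n => gauge_pow_snd hr0 hr1 delta0 delta1 ball (u m - u n)).
exists (l1, l2) => e e0.
have e2 : 0 < (e / 2) `^ r^-1 by rewrite powR_gt0// divr_gt0.
have [N1 H1] := h1 _ e2; have [N2 H2] := h2 _ e2.
exists (maxn N1 N2) => n; rewrite geq_max => /andP[n1 n2].
rewrite gauge_powr//; apply: le_lt_trans; first exact: gauge_pow_norms.
have half (a : R) : 0 <= a -> a < (e / 2) `^ r^-1 -> a `^ r < e / 2.
  move=> a0 /(@gt0_ltr_powR R r hr0); rewrite !nnegrE a0 powR_ge0 => /(_ isT isT).
  by rewrite root_powRK// divr_ge0 ?ltW.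
have := half _ (normr_ge0 _) (H1 _ n1); have := half _ (normr_ge0 _) (H2 _ n2).
rewrite /=; lra.
Qed.

Lemma hausdorff_le (Z : Type) (d : Z -> Z -> R) (A B : set Z) (e : R) :
  (forall a, A a -> exists2 b, B b & d a b <= e) ->
  (forall b, B b -> exists2 a, A a & d a b <= e) ->
  (hausdorff d A B <= e%:E)%E.
Proof.
move=> hA hB; rewrite /hausdorff ge_max; apply/andP; split.
  apply: ub_ereal_sup => _ [a /hA[b Bb dab] <-].
  by apply: le_trans (ereal_inf_lbound _) _; first (exists b => //); rewrite lee_fin.
apply: ub_ereal_sup => _ [b /hB[a Aa dab] <-].
by apply: le_trans (ereal_inf_lbound _) _; first (exists a => //); rewrite lee_fin.
Qed.

Lemma d_r_le (X Y : completeNormedModType R) (delta : R) (rel : X -> Y -> Prop) :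
  0 < delta -> delta <= 1 ->
  (forall x y, rel x y -> `|x| <= 1 /\ `|y| <= 1) ->
  (forall x, `|x| <= 1 -> exists y, rel x y) ->
  (forall y, `|y| <= 1 -> exists x, rel x y) ->
  sum_stable r delta rel -> (d_r r X Y <= delta%:E)%E.
Proof.
move=> delta0 delta1 ball dom ran stable.
pose Z : lmodType R := (X * Y)%type.
pose nZ : Z -> R := gauge r delta rel.
pose T (x : X) : Z := (x, 0); pose S (y : Y) : Z := (0, y).
have near x y : rel x y -> nZ (T x - S y) <= delta.
  have -> : T x - S y = (x, - y).
    by congr pair; rewrite /= ?subr0 ?sub0r.
  exact: gauge_pair_le.
apply: le_trans (ereal_inf_lbound _) _.
  exists Z, nZ, T, S; split; [exact: gauge_is_rnorm | exact: gauge_complete | | |by []].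
  - split=> [a x y|x]; last exact: gauge_coord_fst.
    by congr pair; rewrite /= scaler0 addr0.
  - split=> [a x y|y]; last exact: gauge_coord_snd.
    by congr pair; rewrite /= scaler0 addr0.
apply: hausdorff_le => [_ [x x1 <-]|_ [y y1 <-]].
  have [y hxy] := dom _ x1; exists (S y); last exact: near.
  by exists y => //; have [_] := ball _ _ hxy.
have [x hxy] := ran _ y1; exists (T x); last exact: near.
by exists x => //; have [] := ball _ _ hxy.
Qed.

End Completeness.

(** * The lower bound *)

Section Gluing.
Variables (R : realType) (X Y : normedModType R) (eps : R) (rel : X -> Y -> Prop).
Hypothesis eps0 : 0 < eps.
Hypothesis isom : near_isometry (2 * eps) rel.

(** The infimal length of a path from [x] to [y] crossing one bridge of length [eps] between related
    points. It is defined on the whole spaces, so that [inl] and [inr] serve as embeddings. *)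
Definition cross_dist (x : X) (y : Y) : R :=
  inf [set t | exists x' y', rel x' y' /\ t = `|x - x'| + eps + `|y - y'|].

Definition glue_dist (u v : X + Y) : R :=
  match u, v with
  | inl x, inl x' => `|x - x'|
  | inr y, inr y' => `|y - y'|
  | inl x, inr y | inr y, inl x => cross_dist x y
  end.

Lemma cross_dist_le x y x' y' :
  rel x' y' -> cross_dist x y <= `|x - x'| + eps + `|y - y'|.
Proof.
move=> h; apply: ge_inf; last by exists x', y'.
by exists 0 => _ [x0 [y0 [_ ->]]]; rewrite !addr_ge0// ltW.
Qed.

Lemma cross_dist_ge x y (m : R) :
  (forall x' y', rel x' y' -> m <= `|x - x'| + eps + `|y - y'|) ->
  m <= cross_dist x y.
Proof.
move=> h; apply: lb_le_inf => [|_ [x0 [y0 [h0 ->]]]]; last exact: h.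
case: isom => _ dom _ _; have [|y0 h0] := dom 0; first by rewrite normr0.
by exists (`|x - 0| + eps + `|y - y0|), 0, y0.
Qed.

Lemma cross_dist_gt0 x y : 0 < cross_dist x y.
Proof.
apply: lt_le_trans eps0 _; apply: cross_dist_ge => x' y' _.
by have := normr_ge0 (x - x'); have := normr_ge0 (y - y'); lra.
Qed.

Lemma cross_dist_lipl x x' y : cross_dist x y <= `|x - x'| + cross_dist x' y.
Proof.
rewrite -lerBlDl; apply: cross_dist_ge => x0 y0 h0.
have := cross_dist_le x y h0; have := ler_distD x' x x0; lra.
Qed.

Lemma cross_dist_lipr x y y' : cross_dist x y <= `|y - y'| + cross_dist x y'.
Proof.
rewrite -lerBlDl; apply: cross_dist_ge => x0 y0 h0.
have := cross_dist_le x y h0; have := ler_distD y' y y0; lra.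
Qed.

(** A path from [x] to [x'] through [y] crosses two bridges, whose total length [2 * eps] pays
    exactly for the distortion of [rel]. *)
Lemma cross_dist_trianglel x x' y : `|x - x'| <= cross_dist x y + cross_dist x' y.
Proof.
rewrite -lerBlDr; apply: cross_dist_ge => x1 y1 h1.
rewrite lerBlDr -lerBlDl; apply: cross_dist_ge => x2 y2 h2.
case: isom => _ _ _ /(_ _ _ _ _ h1 h2) /ler_normlP[h _].
have := ler_distD x1 x x'; have := ler_distD x2 x1 x'.
rewrite (distrC x2 x').
have := ler_distD y y1 y2; rewrite (distrC y1 y); lra.
Qed.

Lemma cross_dist_triangler x y y' : `|y - y'| <= cross_dist x y + cross_dist x y'.
Proof.
rewrite -lerBlDr; apply: cross_dist_ge => x1 y1 h1.
rewrite lerBlDr -lerBlDl; apply: cross_dist_ge => x2 y2 h2.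
case: isom => _ _ _ /(_ _ _ _ _ h1 h2) /ler_normlP[_ h].
have := ler_distD y1 y y'; have := ler_distD y2 y1 y'.
rewrite (distrC y2 y').
have := ler_distD x x1 x2; rewrite (distrC x1 x); lra.
Qed.

Lemma glue_dist_metric : is_metric glue_dist.
Proof.
split.
- by case=> [x|y] [x'|y'] /=; rewrite ?normr_ge0// ltW// cross_dist_gt0.
- case=> [x|y] [x'|y'] /=.
  + split=> [/eqP|[->]]; last by rewrite subrr normr0.
    by rewrite normr_eq0 subr_eq0 => /eqP ->.
  + by split=> // h; have := cross_dist_gt0 x y'; rewrite h ltxx.
  + by split=> // h; have := cross_dist_gt0 x' y; rewrite h ltxx.
  + split=> [/eqP|[->]]; last by rewrite subrr normr0.
    by rewrite normr_eq0 subr_eq0 => /eqP ->.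
- by case=> [x|y] [x'|y'] //=; rewrite distrC.
- case=> [x|y] [x'|y'] [x''|y''] /=.
  + exact: ler_distD.
  + exact: cross_dist_lipl.
  + exact: cross_dist_trianglel.
  + by rewrite addrC (distrC y' y''); exact: cross_dist_lipr.
  + by rewrite addrC (distrC x' x''); exact: cross_dist_lipl.
  + exact: cross_dist_triangler.
  + exact: cross_dist_lipr.
  + exact: ler_distD.
Qed.

Lemma dGH_le : (dGH X Y <= eps%:E)%E.
Proof.
have [ball dom ran _] := isom.
have close x y : rel x y -> cross_dist x y <= eps.
  by move=> /(cross_dist_le x y); rewrite !subrr !normr0 addr0 add0r.
apply: le_trans (ereal_inf_lbound _) _.
  exists (X + Y)%type, glue_dist, inl, inr; split; [|by []|by []|by []].
  exact: glue_dist_metric.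
apply: hausdorff_le => [_ [x x1 <-]|_ [y y1 <-]].
  have [y hxy] := dom _ x1; exists (inr y); last exact: close.
  by exists y => //; have [_] := ball _ _ hxy.
have [x hxy] := ran _ y1; exists (inl x); last exact: close.
by exists x => //; have [] := ball _ _ hxy.
Qed.

End Gluing.

Section LowerBound.
Variable R : realType.

Lemma hausdorff_lt (Z : Type) (d : Z -> Z -> R) (A B : set Z) (e : R) :
  (hausdorff d A B < e%:E)%E ->
  (forall a, A a -> exists2 b, B b & d a b < e) /\
  (forall b, B b -> exists2 a, A a & d a b < e).
Proof.
rewrite /hausdorff gt_max => /andP[hA hB]; split=> [a Aa|b Bb].
  have : (ereal_inf [set (d a b)%:E | b in B] < e%:E)%E.
    by apply: le_lt_trans hA; apply: ereal_sup_ubound; exists a.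
  by move=> /ereal_inf_lt[_ [b Bb <-]]; rewrite lte_fin; exists b.
have : (ereal_inf [set (d a b)%:E | a in A] < e%:E)%E.
  by apply: le_lt_trans hB; apply: ereal_sup_ubound; exists b.
by move=> /ereal_inf_lt[_ [a Aa <-]]; rewrite lte_fin; exists a.
Qed.

Lemma hausdorff_ge0 (Z : Type) (d : Z -> Z -> R) (A B : set Z) :
  (exists a, A a) -> (forall x y, 0 <= d x y) -> (0 <= hausdorff d A B)%E.
Proof.
move=> [a Aa] d0; rewrite /hausdorff le_max; apply/orP; left.
apply: (@le_trans _ _ (ereal_inf [set (d a b)%:E | b in B])).
  by apply: le_ereal_inf_tmp => _ [b _ <-]; rewrite lee_fin.
by apply: ereal_sup_ubound; exists a.
Qed.

Variables (r : R).
Hypotheses (hr0 : 0 < r) (hr1 : r < 1).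

Section RNorm.
Variables (Z : lmodType R) (nZ : Z -> R).
Hypothesis hnZ : is_rnorm r nZ.

Lemma rnorm_ge0 z : 0 <= nZ z.
Proof.
case: hnZ => pos homog _; have [->|/pos/ltW//] := eqVneq z 0.
by have := homog 0 0; rewrite scale0r normr0 mul0r => ->.
Qed.

Lemma rnormN z : nZ (- z) = nZ z.
Proof. by case: hnZ => _ homog _; rewrite -scaleN1r homog normrN1 mul1r. Qed.

(* The triangle inequality in [Z] alone would only bound the distortion by a
   multiple of [e `^ r]. Approximating the direction of [x1 - x2] instead of the
   difference itself compares norms inside the Banach space [Y]. *)
Lemma rnorm_distortion (X Y : normedModType R) (T : X -> Z) (S : Y -> Z) (e : R) :
  lin_isometry nZ T -> lin_isometry nZ S -> 0 <= e ->
  (forall x, `|x| <= 1 -> exists2 y, `|y| <= 1 & nZ (T x - S y) <= e) ->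
  forall x1 y1 x2 y2, `|x1| <= 1 -> `|x2| <= 1 ->
    nZ (T x1 - S y1) <= e -> nZ (T x2 - S y2) <= e ->
    `|y1 - y2| <= `|x1 - x2| + 2 `^ (2 / r) * e.
Proof.
move=> [linT isoT] [linS isoS] e0 dom x1 y1 x2 y2 x1_1 x2_1 h1 h2.
have [_ homog tri] := hnZ.
have t0 := normr_ge0 (x1 - x2); set t := `|x1 - x2| in t0 *.
(* If [x1 = x2] then [t^-1 = 0] and the direction is [0], which serves as well. *)
have [u1 eu] : `|t^-1 *: (x1 - x2)| <= 1 /\ t *: (t^-1 *: (x1 - x2)) = x1 - x2.
  have [tz|tn] := eqVneq t 0.
    have /eqP := tz; rewrite normr_eq0 => /eqP ->.
    by rewrite !scaler0 normr0.
  by rewrite normrZ normfV normr_id mulVf// scalerA divff// scale1r.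
set u := t^-1 *: (x1 - x2) in u1 eu.
have [v v1 huv] := dom _ u1.
have T0 : T 0 = 0 by have := linT (-1) 0 0; rewrite scaler0 addr0 scaleN1r addNr.
have S0 : S 0 = 0 by have := linS (-1) 0 0; rewrite scaler0 addr0 scaleN1r addNr.
have eT : T x1 - T x2 = t *: T u.
  have := linT t u 0; rewrite addr0 T0 addr0 => <-; rewrite eu.
  by have := linT (-1) x2 x1; rewrite !scaleN1r ![- _ + _]addrC => ->.
have eS : S (y1 - y2 - t *: v) = S y1 - S y2 - t *: S v.
  have -> : y1 - y2 - t *: v = (- t) *: v + (-1 *: y2 + y1) by lin_eq R Y.
  by rewrite !linS; lin_eq R Z.
(* The [4] is [1 + 1 + 2]: [e] to the power [r] from each given pair, and [t] to the power [r] times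
   as much from the direction, where [t <= 2] and [r < 1]. *)
have key : nZ (S (y1 - y2 - t *: v)) `^ r <= 4 * e `^ r.
  have -> : S (y1 - y2 - t *: v) =
      - (T x1 - S y1) + ((T x2 - S y2) + t *: (T u - S v)).
    have -> : t *: (T u - S v) = T x1 - T x2 - t *: S v by rewrite scalerBr eT.
    by rewrite eS; lin_eq R Z.
  apply: le_trans (tri _ _) _; rewrite rnormN.
  have := tri (T x2 - S y2) (t *: (T u - S v)).
  rewrite homog powRM ?rnorm_ge0// ger0_norm//.
  have t2 : t <= 2 by rewrite /t; have := ler_normB x1 x2; lra.
  have tr : t `^ r <= 2.
    apply: le_trans (ler_powR2 (ltW hr0) t0 t2) _.
    have := @ler_powR R 2 _ r 1; rewrite powRr1//; apply; last exact: ltW.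
    by rewrite ler1n.
  have := ler_powR2 (ltW hr0) (rnorm_ge0 _) h1.
  have := ler_powR2 (ltW hr0) (rnorm_ge0 _) h2.
  have h3 := ler_powR2 (ltW hr0) (rnorm_ge0 _) huv.
  have := ler_pM (powR_ge0 t r) (powR_ge0 _ r) tr h3.
  lra.
have {key} : `|y1 - y2 - t *: v| <= 2 `^ (2 / r) * e.
  rewrite -isoS -[leLHS](powR_rootK hr0) ?rnorm_ge0//.
  apply: le_trans (ler_root hr0 (powR_ge0 _ _) key) _.
  rewrite powRM ?powR_ge0// powR_rootK// powRrM powR_mulrn//.
  by rewrite -natrX.
move=> key; have := ler_normD2 key (ler_normZ2 t v1); rewrite subrK ger0_norm//; lra.
Qed.

End RNorm.

Lemma dGH_le_d_r (X Y : normedModType R) :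
  ((2 `^ (- (2 / r) + 1))%:E * dGH X Y <= d_r r X Y)%E.
Proof.
apply: le_ereal_inf_tmp => h [Z [nZ [T [S [hnZ _ hT hS ->]]]]].
set H := hausdorff _ _ _.
have H0 : (0 <= H)%E.
  apply: hausdorff_ge0 => [|x y]; last exact: rnorm_ge0 hnZ _.
  by exists (T 0), 0 => //=; rewrite /unit_ball/= normr0.
(* Distances need not be attained, so the estimate is made for every real [e] above [H], and [e]
   then decreases to [H]. *)
have below (e : R) : 0 < e -> (H < e%:E)%E ->
    ((2 `^ (- (2 / r) + 1))%:E * dGH X Y <= e%:E)%E.
  move=> e0 /hausdorff_lt [hX hY].
  have domX x : `|x| <= 1 -> exists2 y, `|y| <= 1 & nZ (T x - S y) <= e.
    move=> x1; have [|_ [y y1 <-] hy] := hX (T x); first by exists x.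
    by exists y => //; exact: ltW.
  have domY y : `|y| <= 1 -> exists2 x, `|x| <= 1 & nZ (S y - T x) <= e.
    move=> y1; have [|_ [x x1 <-] hx] := hY (S y); first by exists y.
    by exists x => //; rewrite -(rnormN hnZ) opprB ltW.
  pose rel x y := [/\ `|x| <= 1, `|y| <= 1 & nZ (T x - S y) <= e].
  (* Half the distortion given by [rnorm_distortion], as [dGH_le] turns distortion [2 * c] into
     distance [c]. *)
  pose c : R := 2 `^ (2 / r - 1) * e.
  have c0 : 0 < c by rewrite mulr_gt0// powR_gt0.
  have cc : 2 * c = 2 `^ (2 / r) * e.
    by rewrite /c mulrA mulr_powRB1// divr_gt0.
  have isom : near_isometry (2 * c) rel.
    split=> [x y []//|x x1|y y1|x1 y1 x2 y2 [bx1 by1 h1] [bx2 by2 h2]].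
    - by have [y y1 hy] := domX _ x1; exists y.
    - have [x x1 hx] := domY _ y1; exists x; split=> //.
      by rewrite -(rnormN hnZ) opprB.
    - have k1 := rnorm_distortion hnZ hT hS (ltW e0) domX bx1 bx2 h1 h2.
      rewrite -(rnormN hnZ) opprB in h1; rewrite -(rnormN hnZ) opprB in h2.
      have k2 := rnorm_distortion hnZ hS hT (ltW e0) domY by1 by2 h1 h2.
      by rewrite cc; apply/ler_normlP; split; lra.
  have cE : 2 `^ (- (2 / r) + 1) * c = e.
    rewrite /c mulrA -powRD; last by rewrite pnatr_eq0 implybT.
    have -> : - (2 / r) + 1 + (2 / r - 1) = 0 by ring.
    by rewrite powRr0 mul1r.
  rewrite -cE EFinM; apply: lee_wpmul2l; first by rewrite lee_fin powR_ge0.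
  exact: dGH_le c0 isom.
case: H H0 below => [h0| |] // H0 below; last by rewrite leey.
rewrite lee_fin in H0; apply/lee_addgt0Pr => e e0.
rewrite -EFinD; apply: below; first by lra.
by rewrite lte_fin; lra.
Qed.

End LowerBound.

(** * The upper bound *)

(** As [e < 2 * e], some pair of embeddings has Hausdorff distance below [2 * e]. Relating points
    closer than that changes distances by at most [2 * e] at each end. *)
Lemma dGH_near_isometry (R : realType) (X Y : normedModType R) (e eps : R) :
  dGH X Y = e%:E -> 0 < e -> 4 * e <= eps ->
  exists rel : X -> Y -> Prop, near_isometry eps rel.
Proof.
move=> eXY e0 heps.
have : (dGH X Y < (2 * e)%:E)%E by rewrite eXY lte_fin; lra.
move=> /ereal_inf_lt[_ [Z [d [i [j [hd hi hj ->]]]]] /hausdorff_lt[hX hY]].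
have [_ _ dsym dtri] := hd.
exists (fun x y => [/\ `|x| <= 1, `|y| <= 1 & d (i x) (j y) < 2 * e]).
split=> [x y []//|x x1|y y1|x y x' y' [x1 y1 h] [x1' y1' h']].
- by have [|_ [y y1 <-] hy] := hX (i x); [exists x|exists y].
- by have [|_ [x x1 <-] hx] := hY (j y); [exists y|exists x].
rewrite -(hi _ _ x1 x1') -(hj _ _ y1 y1').
have := dtri (i x) (j y) (i x'); have := dtri (j y) (j y') (i x').
have := dtri (j y) (i x) (j y'); have := dtri (i x) (i x') (j y').
rewrite (dsym (j y') (i x')) (dsym (j y) (i x)) => *.
by apply/ler_normlP; split; lra.
Qed.

Lemma d_r_le1 (R : realType) (r : R) (X Y : completeNormedModType R) :
  0 < r -> r < 1 -> (d_r r X Y <= 1%:E)%E.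
Proof.
move=> hr0 hr1.
apply: (d_r_le hr0 hr1 (rel := fun x y => `|x| <= 1 /\ `|y| <= 1)) => //.
- by move=> x x1; exists 0; rewrite normr0.
- by move=> y y1; exists 0; rewrite normr0.
- exact: sum_stable1.
Qed.

(** The point is uniformity: [eps] depends on [r] and [delta] but not on the spaces, which makes [f]
    tend to [0]. *)
Lemma d_r_small (R : realType) (r delta : R) : 0 < r -> r < 1 -> 0 < delta <= 1 ->
  exists2 eps : R, 0 < eps & forall (X Y : completeNormedModType R) (e : R),
    0 < e < eps -> dGH X Y = e%:E -> (d_r r X Y <= delta%:E)%E.
Proof.
move=> hr0 hr1 /andP[delta0 delta1].
have [eps eps0 stable] := near_isometry_sum_stable hr0 hr1 delta0.
exists (eps / 4) => [|X Y e /andP[e0 heps] eXY]; first by rewrite divr_gt0.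
have [|rel isom] := dGH_near_isometry (eps := eps) eXY e0; first by lra.
have [ball dom ran _] := isom.
exact: d_r_le (stable _ _ _ isom).
Qed.

Theorem theorem3p6 (R : realType) (r : R) (hr0 : 0 < r) (hr1 : r < 1) :
  exists f : R -> R,
    (forall e : R, 0 < e <= 1 -> 0 < f e <= 1) /\
    (f x @[x --> 0^'+] --> 0) /\
    (forall X Y : completeNormedModType R,
       ((2 `^ (- (2 / r) + 1))%:E * dGH X Y <= d_r r X Y)%E /\
       (forall e : R, dGH X Y = e%:E -> 0 < e -> (d_r r X Y <= (f e)%:E)%E)).
Proof.
pose bounds e := [set eta : R | 0 < eta <= 1 /\
  forall X Y : completeNormedModType R, dGH X Y = e%:E -> (d_r r X Y <= eta%:E)%E].
(* Adding [e] makes [f] positive and leaves slack for an infimum that may not be attained; the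
   minimum with [1] keeps the values in range. *)
pose f e := Num.min 1 (inf (bounds e) + e).
have has_inf_bounds e : has_inf (bounds e).
  split; first by exists 1; split=> [|X Y _]; [rewrite ltr01 lexx|exact: d_r_le1].
  by exists 0 => eta [/andP[/ltW]].
have inf_ge0 e : 0 <= inf (bounds e).
  by apply: lb_le_inf (has_inf_bounds e).1 _ => eta [/andP[/ltW]].
exists f; split=> [e /andP[e0 e1]|].
  rewrite /f lt_min ltr01 ge_min lexx /= andbT.
  by have := inf_ge0 e; lra.
split=> [|X Y]; last split=> [|e eXY e0].
- apply/cvgrPdist_lt => del del0.
  pose delta := Num.min 1 (del / 2).
  have delta01 : 0 < delta <= 1 by rewrite lt_min ltr01 divr_gt0//= ge_min lexx.
  have delta_del : delta <= del / 2 by rewrite ge_min lexx orbT.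
  have [eps eps0 heps] := d_r_small hr0 hr1 delta01.
  near=> x.
  have x0 : 0 < x by near: x; exact: nbhs_right_gt.
  have xeps : x < eps by near: x; exact: nbhs_right_lt.
  have xdel : x < del / 2 by near: x; apply: nbhs_right_lt; rewrite divr_gt0.
  (* Below [eps], [delta] itself is an admissible bound by [d_r_small]. *)
  have infx : inf (bounds x) <= delta.
    apply: ge_inf; first exact: (has_inf_bounds x).2.
    split=> // X Y.
    by apply: heps; rewrite x0.
  have := inf_ge0 x; have fx : f x <= inf (bounds x) + x by rewrite ge_min lexx orbT.
  have fx0 : 0 <= f x by rewrite le_min ler01 addr_ge0// ltW.
  by rewrite sub0r normrN ger0_norm//; lra.
- exact: dGH_le_d_r.
- have [eta [_ heta] eta_lt] := inf_adherent e0 (has_inf_bounds e).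
  rewrite /f EFin_min le_min d_r_le1//=.
  by apply: le_trans (heta _ _ eXY) _; rewrite lee_fin ltW.
Unshelve. all: by end_near. Qed.
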